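(* Let $R$ be an associative unital ring and $M$ an $R$-complex, and assume that one of the following conditions holds. (a) $R$ is left noetherian and $M$ is a complex of injective $R$-modules. (b) $R$ is left perfect and $M$ is a complex of projective $R$-modules. (c) $R$ is semi-perfect and $M$ is a complex of finitely generated projective $R$-modules. (d) $R$ is left noetherian and $M$ is a complex of finitely generated projective $R$-modules. Let $0\to P\to M\to M/P\to 0$ be a pure exact sequence in $\mathcal{C}(R)$ with $P$ a pure-acyclic subcomplex of $M$ and $M/P$ pure-minimal (such a sequence exists for every $R$-complex $M$). Then this sequence is split in $\mathcal{C}(R)$ and yields a decomposition $M\cong P\oplus (M/P)$, where $P$ is contractible and $M/P$ is pure-minimal.
   Context: $R$-modules are left modules. An $R$-complex is a (possibly unbounded) chain complex $M$ of $R$-modules, indexed homologically; $Z_i(M)=\operatorname{Ker}(\partial_i^M)$; $\mathcal{C}(R)$ is the category of $R$-complexes and chain maps, with hom-sets $\operatorname{hom}_{\mathcal{C}(R)}(L,M)$. A complex is contractible if its identity map is null-homotopic. An exact sequence of $R$-modules is pure if $\operatorname{Hom}_R(A,-)$ leaves it exact for every finitely presented $R$-module $A$. An exact sequence $0\to L\to M\to N\to 0$ of $R$-complexes is pure if $0\to\operatorname{hom}_{\mathcal{C}(R)}(A,L)\to\operatorname{hom}_{\mathcal{C}(R)}(A,M)\to\operatorname{hom}_{\mathcal{C}(R)}(A,N)\to 0$ is exact for every bounded complex $A$ of finitely presented $R$-modules. A subcomplex $L\subseteq M$ is pure if $0\to L\to M\to M/L\to 0$ is pure. An $R$-complex $M$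 is pure-acyclic if it is acyclic and $0\to Z_i(M)\to M_i\to Z_{i-1}(M)\to 0$ is a pure exact sequence of $R$-modules for every $i\in\mathbb{Z}$. An $R$-complex is pure-minimal if the zero complex is its only pure-acyclic pure subcomplex. *)

(* Defs.v *)
From HB Require Import structures.
From mathcomp Require Import all_boot all_order all_algebra.

Set Implicit Arguments.
Unset Strict Implicit.
Unset Printing Implicit Defensive.

Import Order.TTheory GRing.Theory Num.Theory.

Local Open Scope ring_scope.
Local Open Scope quotient_scope.

(* A submodule of V is a boolean predicate S : submodClosed V.  With the
   classical axioms every Prop-valued predicate has such a form, and every
   type carries the choice structure that lmodType asks for. *)

Section Submodules.
Variables (R : pzRingType) (V : lmodType R).

Definition submod_of (S : submodClosed V) : Type := {x : V | x \in S}.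

Section Sub.
Variable S : submodClosed V.

HB.instance Definition _ := [isSub of submod_of S for sval].
HB.instance Definition _ := [Choice of submod_of S by <:].
HB.instance Definition _ := [SubChoice_isSubLmodule of submod_of S by <:].

(* S with the closure under opposites that the quotient group requires *)
Definition submod_pred : {pred V} := fun x => x \in S.

Lemma submod_pred_zmod_closed : zmod_closed submod_pred.
Proof.
split; first exact: (rpred0 S).
move=> x y xS yS; rewrite -[_ \in _]/(x - y \in S) -scaleN1r.
by apply: (rpredD (S := S)) => //; apply: rpredZ.
Qed.

HB.instance Definition _ :=
  GRing.isZmodClosed.Build V submod_pred submod_pred_zmod_closed.

Definition quot_mod : Type := Quotient.quot submod_pred.

HB.instance Definition _ := GRing.Zmodule.on quot_mod.

Definition quot_pi (x : V) : quot_mod := \pi_(Quotient.quot submod_pred) x.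
Definition quot_repr (x : quot_mod) : V := repr (x : Quotient.quot submod_pred).

Lemma quot_reprK : cancel quot_repr quot_pi.
Proof. exact: reprK. Qed.

Lemma quot_piP x y : (quot_pi x = quot_pi y) <-> (x - y \in S).
Proof.
rewrite -[x - y \in S]/(x - y \in submod_pred) Quotient.idealrBE.
by split=> [xy|/eqP //]; apply/eqP; exact: xy.
Qed.

Lemma quot_piB : {morph quot_pi : x y / x - y}.
Proof. exact: (raddfB (\pi_(Quotient.quot submod_pred))). Qed.

Lemma quot_piD : {morph quot_pi : x y / x + y}.
Proof. exact: (raddfD (\pi_(Quotient.quot submod_pred))). Qed.

Definition quot_scale (a : R) (x : quot_mod) : quot_mod :=
  quot_pi (a *: quot_repr x).

Lemma quot_piZ a x : quot_pi (a *: x) = quot_scale a (quot_pi x).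
Proof.
by apply/quot_piP; rewrite -scalerBr rpredZ //; apply/quot_piP;
   rewrite quot_reprK.
Qed.

Lemma quot_scaleA a b x : quot_scale a (quot_scale b x) = quot_scale (a * b) x.
Proof. by rewrite -[x]quot_reprK -!quot_piZ scalerA. Qed.
Lemma quot_scale1 : left_id 1 quot_scale.
Proof. by move=> x; rewrite -[x]quot_reprK -quot_piZ scale1r. Qed.
Lemma quot_scaleDr : right_distributive quot_scale +%R.
Proof.
move=> a x y; rewrite -[x]quot_reprK -[y]quot_reprK.
by rewrite -quot_piD -!quot_piZ -quot_piD scalerDr.
Qed.
Lemma quot_scaleDl x : {morph quot_scale^~ x : a b / a + b}.
Proof.
by move=> a b; rewrite -[x]quot_reprK -!quot_piZ -quot_piD scalerDl.
Qed.

HB.instance Definition _ := GRing.Zmodule_isLmodule.Build R quot_mod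
  quot_scaleA quot_scale1 quot_scaleDr quot_scaleDl.

Lemma quot_pi_is_linear : linear quot_pi.
Proof. by move=> a x y; rewrite quot_piD quot_piZ. Qed.

HB.instance Definition _ := GRing.isLinear.Build R V quot_mod *:%R quot_pi
  quot_pi_is_linear.

Definition sub_incl : {linear submod_of S -> V} := (\val : submod_of S -> V).
Definition sub_proj : {linear V -> quot_mod} := quot_pi.

End Sub.
End Submodules.

Section LinearMaps.
Variable R : pzRingType.

Section Ker.
Variables (U V : lmodType R) (f : {linear U -> V}).

Definition ker_pred : {pred U} := fun x => f x == 0.

Lemma ker_pred_closed : submod_closed ker_pred.
Proof.
split; first by rewrite -[_ \in _]/(f 0 == 0) linear0.
move=> a x y /eqP fx /eqP fy; apply/eqP.
by rewrite linearP fx fy scaler0 addr0.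
Qed.

HB.instance Definition _ := GRing.isSubmodClosed.Build R U ker_pred
  ker_pred_closed.

Definition kernel : submodClosed U := ker_pred.

End Ker.

Section Corestriction.
Variables (U V : lmodType R) (f : {linear U -> V}) (S : submodClosed V).
Hypothesis fS : forall x, f x \in S.

Definition cores_fun (x : U) : submod_of S := exist _ (f x) (fS x).

Lemma cores_is_linear : linear cores_fun.
Proof. by move=> a x y; apply: val_inj; rewrite /= linearP. Qed.

HB.instance Definition _ := GRing.isLinear.Build R U (submod_of S) *:%R
  cores_fun cores_is_linear.

Definition cores : {linear U -> submod_of S} := cores_fun.
End Corestriction.

Section QuotientMap.
Variables (U V : lmodType R) (f : {linear U -> V}).
Variables (S : submodClosed U) (T : submodClosed V).
Hypothesis fST : forall x, x \in S -> f x \in T.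

Definition quot_map_fun (x : quot_mod S) : quot_mod T :=
  quot_pi T (f (quot_repr x)).

Lemma quot_map_pi x : quot_map_fun (quot_pi S x) = quot_pi T (f x).
Proof.
apply/quot_piP; rewrite -linearB; apply: fST.
by apply/quot_piP; rewrite quot_reprK.
Qed.

Lemma quot_map_is_linear : linear quot_map_fun.
Proof.
move=> a x y; rewrite -[x]quot_reprK -[y]quot_reprK -linearP.
by rewrite !quot_map_pi !linearP.
Qed.

HB.instance Definition _ := GRing.isLinear.Build R (quot_mod S) (quot_mod T)
  *:%R quot_map_fun quot_map_is_linear.

Definition quot_map : {linear quot_mod S -> quot_mod T} := quot_map_fun.
End QuotientMap.

Section ProductMap.
Variables (U V U' V' : lmodType R).
Variables (f : {linear U -> U'}) (g : {linear V -> V'}).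

Definition prod_map_fun (x : U * V) : U' * V' := (f x.1, g x.2).

Lemma prod_map_is_linear : linear prod_map_fun.
Proof. by move=> a x y; rewrite /prod_map_fun /= !linearP. Qed.

HB.instance Definition _ := GRing.isLinear.Build R (U * V)%type (U' * V')%type
  *:%R prod_map_fun prod_map_is_linear.

Definition prod_map : {linear (U * V)%type -> (U' * V')%type} := prod_map_fun.
End ProductMap.

End LinearMaps.

Section Modules.
Variable R : pzRingType.

(* 'rV[R]_n is the free left module R^n *)
Definition fin_generated (A : lmodType R) : Prop :=
  exists (n : nat) (p : {linear 'rV[R]_n -> A}), forall a, exists v, p v = a.

(* exactness of R^m -> R^n -> A -> 0 *)
Definition fin_presented (A : lmodType R) : Prop :=
  exists (m n : nat) (q : {linear 'rV[R]_m -> 'rV[R]_n})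
         (p : {linear 'rV[R]_n -> A}),
    (forall a, exists v, p v = a) /\
    (forall v, p v = 0 <-> exists w, q w = v).

Definition projective_mod (P : lmodType R) : Prop :=
  forall (A B : lmodType R) (g : {linear A -> B}) (f : {linear P -> B}),
    (forall b, exists a, g a = b) ->
    exists h : {linear P -> A}, forall x, g (h x) = f x.

Definition injective_mod (E : lmodType R) : Prop :=
  forall (A B : lmodType R) (g : {linear A -> B}) (f : {linear A -> E}),
    injective g ->
    exists h : {linear B -> E}, forall x, h (g x) = f x.

(* 0 -> L -> M -> N -> 0 *)
Definition short_exact (L M N : lmodType R)
    (f : {linear L -> M}) (g : {linear M -> N}) : Prop :=
  [/\ injective f,
      forall y, g y = 0 <-> exists x, f x = y
    & forall z, exists y, g y = z].

(* 0 -> Hom(A,L) -> Hom(A,M) -> Hom(A,N) -> 0 *)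
Definition hom_exact (A L M N : lmodType R)
    (f : {linear L -> M}) (g : {linear M -> N}) : Prop :=
  [/\ forall u u' : {linear A -> L}, f \o u =1 f \o u' -> u =1 u',
      forall v : {linear A -> M},
        g \o v =1 \0 <-> exists u : {linear A -> L}, f \o u =1 v
    & forall w : {linear A -> N}, exists v : {linear A -> M}, g \o v =1 w].

Definition pure_exact (L M N : lmodType R)
    (f : {linear L -> M}) (g : {linear M -> N}) : Prop :=
  short_exact f g /\ forall A : lmodType R, fin_presented A -> hom_exact A f g.

(* S + T = V implies T = V *)
Definition superfluous (V : lmodType R) (S : submodClosed V) : Prop :=
  forall T : submodClosed V,
    (forall x, exists s t, [/\ s \in S, t \in T & x = s + t]) ->
    forall x, x \in T.

Definition projective_cover (P A : lmodType R) (p : {linear P -> A}) : Prop :=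
  [/\ projective_mod P, forall a, exists x, p x = a & superfluous (kernel p)].

End Modules.

(* R^o is R as a left module over itself: its submodules are the left ideals *)
Definition left_noetherian (R : pzRingType) : Prop :=
  forall I : nat -> submodClosed R^o,
    (forall n x, x \in I n -> x \in I n.+1) ->
    exists n, forall m, (n <= m)%N -> I m =i I n.

Definition left_perfect (R : pzRingType) : Prop :=
  forall A : lmodType R,
    exists (P : lmodType R) (p : {linear P -> A}), projective_cover p.

Definition semi_perfect (R : pzRingType) : Prop :=
  forall A : lmodType R, fin_generated A ->
    exists (P : lmodType R) (p : {linear P -> A}), projective_cover p.

Section Complexes.
Variable R : pzRingType.

(* cx_d i is the differential out of degree i + 1.  As i ranges over all of
   int, so does i + 1; this avoids transports along (i - 1) + 1 = i. *)
Record complex := Complex {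
  cx_mod :> int -> lmodType R;
  cx_d : forall i : int, {linear cx_mod (i + 1) -> cx_mod i};
  cx_dd : forall i x, cx_d i (cx_d (i + 1) x) = 0 }.

Record chain_map (L M : complex) := ChainMap {
  cm_map :> forall i : int, {linear L i -> M i};
  cm_comm : forall i x, cm_map i (cx_d L i x) = cx_d M i (cm_map (i + 1) x) }.

Definition eq_chain (L M : complex) (f g : chain_map L M) : Prop :=
  forall i, f i =1 g i.

Lemma comp_chain_comm (L M N : complex) (g : chain_map M N)
    (f : chain_map L M) i x :
  (g i \o f i) (cx_d L i x) = cx_d N i ((g (i + 1) \o f (i + 1)) x).
Proof. by rewrite /= !cm_comm. Qed.

Definition comp_chain (L M N : complex) (g : chain_map M N)
    (f : chain_map L M) : chain_map L N :=
  @ChainMap L N (fun i => (g i \o f i : {linear L i -> N i}))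
    (comp_chain_comm g f).

Definition id_chain (M : complex) : chain_map M M :=
  @ChainMap M M (fun i => (idfun : {linear M i -> M i})) (fun i x => erefl).

Definition zero_chain (L M : complex) : chain_map L M :=
  @ChainMap L M (fun i => (\0 : {linear L i -> M i}))
    (fun i x => esym (linear0 (cx_d M i))).

Definition chain_iso (L M : complex) (f : chain_map L M) : Prop :=
  exists g : chain_map M L,
    eq_chain (comp_chain g f) (id_chain L) /\
    eq_chain (comp_chain f g) (id_chain M).

(* the identity is null-homotopic: 1 = d s + s d *)
Definition contractible (M : complex) : Prop :=
  exists s : forall i : int, {linear M i -> M (i + 1)},
    forall i (x : M (i + 1)), x = cx_d M (i + 1) (s (i + 1) x) + s i (cx_d M i x).

Definition bounded (M : complex) : Prop :=
  exists a b : int, forall i, (i < a) || (b < i) -> forall x : M i, x = 0.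

Definition acyclic (M : complex) : Prop :=
  forall i (y : M (i + 1)), cx_d M i y = 0 -> exists x, cx_d M (i + 1) x = y.

(* Z_{i+1}(M) *)
Definition cycles (M : complex) (i : int) : submodClosed (M (i + 1)) :=
  kernel (cx_d M i).

Lemma boundary_in_cycles (M : complex) i x : cx_d M (i + 1) x \in cycles M i.
Proof. by apply/eqP; rewrite cx_dd. Qed.

Definition to_cycles (M : complex) (i : int) :
    {linear M (i + 1 + 1) -> submod_of (cycles M i)} :=
  cores (@boundary_in_cycles M i).

(* acyclic, with 0 -> Z_{i+2} -> M_{i+2} -> Z_{i+1} -> 0 pure exact for all i *)
Definition pure_acyclic (M : complex) : Prop :=
  acyclic M /\ forall i, pure_exact (sub_incl (cycles M (i + 1))) (to_cycles M i).

Definition short_exact_cx (L M N : complex)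
    (f : chain_map L M) (g : chain_map M N) : Prop :=
  forall i, short_exact (f i) (g i).

(* 0 -> hom(A,L) -> hom(A,M) -> hom(A,N) -> 0, with hom the chain maps *)
Definition hom_exact_cx (A L M N : complex)
    (f : chain_map L M) (g : chain_map M N) : Prop :=
  [/\ forall u u' : chain_map A L,
        eq_chain (comp_chain f u) (comp_chain f u') -> eq_chain u u',
      forall v : chain_map A M,
        eq_chain (comp_chain g v) (zero_chain A N) <->
        exists u : chain_map A L, eq_chain (comp_chain f u) v
    & forall w : chain_map A N, exists v : chain_map A M,
        eq_chain (comp_chain g v) w].

Definition pure_exact_cx (L M N : complex)
    (f : chain_map L M) (g : chain_map M N) : Prop :=
  short_exact_cx f g /\
  forall A : complex, bounded A -> (forall i, fin_presented (A i)) ->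
    hom_exact_cx A f g.

Definition split_cx (L M N : complex)
    (f : chain_map L M) (g : chain_map M N) : Prop :=
  short_exact_cx f g /\
  exists s : chain_map N M, eq_chain (comp_chain g s) (id_chain N).

Record subcomplex (M : complex) := Subcomplex {
  sc_mod :> forall i : int, submodClosed (M i);
  sc_d : forall i x, x \in sc_mod (i + 1) -> cx_d M i x \in sc_mod i }.

Section SubQuotient.
Variables (M : complex) (P : subcomplex M).

Lemma sub_d_in i (x : submod_of (P (i + 1))) :
  (cx_d M i \o sub_incl (P (i + 1))) x \in P i.
Proof. exact: sc_d (valP x). Qed.

Definition sub_d i : {linear submod_of (P (i + 1)) -> submod_of (P i)} :=
  cores (@sub_d_in i).

Lemma sub_dd i x : sub_d i (sub_d (i + 1) x) = 0.
Proof. by apply: val_inj; rewrite /= cx_dd. Qed.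

Definition sub_cx : complex := @Complex (fun i => submod_of (P i)) sub_d sub_dd.

Definition quot_d i : {linear quot_mod (P (i + 1)) -> quot_mod (P i)} :=
  quot_map (@sc_d M P i).

Lemma quot_d_pi i x : quot_d i (quot_pi _ x) = quot_pi _ (cx_d M i x).
Proof. exact: quot_map_pi (@sc_d M P i) x. Qed.

Lemma quot_dd i x : quot_d i (quot_d (i + 1) x) = 0.
Proof. by rewrite -[x]quot_reprK !quot_d_pi cx_dd linear0. Qed.

Definition quot_cx : complex := @Complex (fun i => quot_mod (P i)) quot_d quot_dd.

Definition incl_cx : chain_map sub_cx M :=
  @ChainMap sub_cx M (fun i => sub_incl (P i)) (fun i x => erefl).

Definition proj_cx : chain_map M quot_cx :=
  @ChainMap M quot_cx (fun i => sub_proj (P i)) (fun i x => esym (quot_d_pi x)).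

End SubQuotient.

Definition pure_subcomplex (M : complex) (L : subcomplex M) : Prop :=
  pure_exact_cx (incl_cx L) (proj_cx L).

Definition pure_minimal (M : complex) : Prop :=
  forall L : subcomplex M, pure_subcomplex L -> pure_acyclic (sub_cx L) ->
    forall i x, x \in L i -> x = 0.

Section DirectSum.
Variables L N : complex.

Definition dsum_d (i : int) :
    {linear (L (i + 1)%R * N (i + 1)%R)%type -> (L i * N i)%type} :=
  prod_map (cx_d L i) (cx_d N i).

Lemma dsum_dd i x : dsum_d i (dsum_d (i + 1) x) = 0.
Proof. by rewrite /= /prod_map_fun /= !cx_dd. Qed.

Definition dsum : complex :=
  @Complex (fun i => (L i * N i)%type : lmodType R) dsum_d dsum_dd.

End DirectSum.

End Complexes.

(* Main.v *)
Require Import Defs.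
From HB Require Import structures.
From mathcomp Require Import all_boot all_order all_algebra.
From mathcomp Require Import boolp classical_sets functions.

Set Implicit Arguments.
Unset Strict Implicit.
Unset Printing Implicit Defensive.

Import Order.TTheory GRing.Theory Num.Theory.

Local Open Scope ring_scope.

(** A pure short exact sequence of complexes is pure in each degree, because
    chain maps out of the disk complex A = A in degrees k + 1 and k are linear
    maps out of A ([pure_epi_cx_degree]).  So P i is pure in M i, and as P is
    pure-acyclic, the cycles of P are pure in the terms of P.  Each of the four
    hypotheses on R and M provides a class of modules that contains the M i, is
    closed under direct summands, and in which every pure epimorphism
    splits ([pure_split_class]):
    - injective modules over a left noetherian ring: R/I is finitely presented
      for every left ideal I, so Baer's criterion passes from an injective module
      to a pure submodule ([pure_kernel_injective]);
    - projective modules whose quotients have projective covers: the kernel K of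
      the cover Q -> W of a pure quotient W is pure and superfluous in Q.  Purity
      makes each x in K a fixed point of an endomorphism of Q with values in K,
      and a Nakayama argument then gives x = 0 ([superfluous_pure_kernel]);
    - finitely generated modules over a left noetherian ring: a quotient of such
      a module is finitely presented, so purity lifts its identity map
      ([noetherian_fin_presented]).
    Consequently P i is a direct summand of M i, and the exact complex P has
    split cycles, so it is contractible ([hom_acyclic_contractible]).  A
    contraction of P turns the retractions M i -> P i into a retraction of
    complexes ([contractible_retract]), which is the required splitting.

    The existence of P is an application of Zorn's lemma to the pure-acyclic pure
    subcomplexes of M: they are closed under unions of chains because bounded
    complexes of finitely presented modules are finitely presented objects
    ([union_sub_pure]).  If P is maximal then M/P is pure-minimal, since a
    pure-acyclic pure subcomplex of M/P has a pure-acyclic pure preimage in M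
    ([preimage_sub_pure], [preimage_sub_acyclic]). *)

(** * Linear maps and submodules *)

Section LinearTools.
Variable R : pzRingType.
Implicit Types U V W A B C : lmodType R.

Definition lin_of U V (f : U -> V) (H : linear f) : {linear U -> V} :=
  HB.pack f (GRing.isLinear.Build R U V *:%R f H).

Definition submodP V (P : V -> Prop) : Prop :=
  P 0 /\ forall a x y, P x -> P y -> P (a *: x + y).

Section Comprehension.
Variables (V : lmodType R) (P : V -> Prop) (PP : submodP P).

Definition comprehension_pred : {pred V} := fun x => `[< P x >].

Lemma comprehension_closed : GRing.submod_closed comprehension_pred.
Proof.
split; first by apply/asboolP; case: PP.
by move=> a x y /asboolP Px /asboolP Py; apply/asboolP; apply: (PP.2).
Qed.

HB.instance Definition _ :=
  GRing.isSubmodClosed.Build R V comprehension_pred comprehension_closed.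

Definition comprehension : submodClosed V := comprehension_pred.

Lemma comprehensionE x : x \in comprehension <-> P x.
Proof. by split=> [/asboolP //|Px]; apply/asboolP. Qed.

End Comprehension.

Lemma submodP_mem V (S : submodClosed V) : submodP (fun x => x \in S).
Proof.
split; first exact: rpred0.
by move=> a x y xS yS; apply: rpredD => //; apply: rpredZ.
Qed.

Lemma submodB V (S : submodClosed V) x y : x \in S -> y \in S -> x - y \in S.
Proof.
by move=> xS yS; rewrite -scaleN1r; apply: rpredD => //; apply: rpredZ.
Qed.

Definition to_sub V (S : submodClosed V) x (xS : x \in S) : submod_of S :=
  exist _ x xS.

Lemma kernelP U V (f : {linear U -> V}) x : x \in kernel f <-> f x = 0.
Proof. by split=> [/eqP //|fx]; apply/eqP. Qed.

Lemma submodP_image U V (f : {linear U -> V}) : submodP (fun y => exists x, f x = y).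
Proof.
split; first by exists 0; rewrite linear0.
by move=> a _ _ [x <-] [y <-]; exists (a *: x + y); rewrite linearP.
Qed.

Definition image_mod U V (f : {linear U -> V}) : submodClosed V :=
  comprehension (submodP_image f).

(** A linear map is the same thing as a submodule of the product that projects
    onto the first factor and meets the second one in 0.  The factorizations
    below, and the extensions of maps to injective modules, are constructed as
    graphs of this kind. *)
Lemma linear_of_graph U V (G : U -> V -> Prop) :
  (forall x, exists y, G x y) ->
  (forall a x y x' y', G x y -> G x' y' -> G (a *: x + x') (a *: y + y')) ->
  (forall y, G 0 y -> y = 0) ->
  exists h : {linear U -> V}, forall x y, G x y <-> y = h x.
Proof.
move=> Gt Gl G0; have [h hG] := choice Gt.
have Gu x y y' : G x y -> G x y' -> y = y'.
  move=> Gy Gy'; apply/eqP; rewrite -subr_eq0 addrC -scaleN1r; apply/eqP/G0.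
  by rewrite -[X in G X _](addNr x) -[in X in G X _](scaleN1r x); apply: Gl.
have hl : linear h.
  by move=> a x y; apply: (Gu (a *: x + y)); [apply: hG | apply: Gl; apply: hG].
exists (lin_of hl) => x y; split=> [Gxy|->]; last exact: hG.
by apply: Gu Gxy _; apply: hG.
Qed.

Lemma factor_surj A B C (g : {linear A -> B}) (f : {linear A -> C}) :
  (forall b, exists a, g a = b) -> (forall a, g a = 0 -> f a = 0) ->
  exists h : {linear B -> C}, forall a, h (g a) = f a.
Proof.
move=> gs gf.
have [||c [a [ga <-]]|h hP] := @linear_of_graph B C
  (fun b c => exists a, g a = b /\ f a = c).
- by move=> b; have [a ga] := gs b; exists (f a), a.
- move=> r _ _ _ _ [a [<- <-]] [a' [<- <-]]; exists (r *: a + a').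
  by rewrite !linearP.
- exact: gf.
- by exists h => a; apply/esym/hP; exists a.
Qed.

Lemma factor_inj A B C (g : {linear B -> C}) (f : {linear A -> C}) :
  injective g -> (forall a, exists b, g b = f a) ->
  exists h : {linear A -> B}, forall a, g (h a) = f a.
Proof.
move=> gi fg.
have [||b gb|h hP] := @linear_of_graph A B (fun a b => g b = f a).
- exact: fg.
- by move=> r a b a' b' e e'; rewrite !linearP e e'.
- by apply: gi; rewrite gb !linear0.
- by exists h => a; apply/hP.
Qed.

Lemma linear_inj U V (f : {linear U -> V}) :
  (forall x, f x = 0 -> x = 0) -> injective f.
Proof.
move=> f0 x y e; apply/eqP; rewrite -subr_eq0; apply/eqP/f0.
by rewrite linearB e subrr.
Qed.

Lemma linear_regular V (h : {linear R^o -> V}) (r : R) : h r = r *: h 1.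
Proof. by rewrite -linearZ; congr (h _); apply/esym/mulr1. Qed.

Lemma quot_pi_eq0 V (S : submodClosed V) x : quot_pi S x = 0 <-> x \in S.
Proof. by rewrite -(linear0 (quot_pi S)) quot_piP subr0. Qed.

Lemma quot_surj V (S : submodClosed V) z : exists x, quot_pi S x = z.
Proof. by exists (quot_repr z); apply: quot_reprK. Qed.

(** * Free modules of finite rank *)

Section LinearCombination.
Variables (V : lmodType R) (n : nat) (y : 'I_n -> V).

Definition lincomb_fun (v : 'rV[R]_n) : V := \sum_i v 0 i *: y i.

Lemma lincomb_is_linear : linear lincomb_fun.
Proof.
move=> a u v; rewrite /lincomb_fun scaler_sumr -big_split /=.
by apply: eq_bigr => i _; rewrite !mxE scalerDl scalerA.
Qed.

Definition lincomb : {linear 'rV[R]_n -> V} := lin_of lincomb_is_linear.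

Lemma lincomb_delta i : lincomb 'e_i = y i.
Proof.
rewrite /= /lincomb_fun (bigD1 i) //= !mxE !eqxx scale1r big1 ?addr0 //.
by move=> j ji; rewrite !mxE eqxx (negPf ji) scale0r.
Qed.

End LinearCombination.

Lemma rV_linear_ext V n (f g : {linear 'rV[R]_n -> V}) :
  (forall i, f 'e_i = g 'e_i) -> f =1 g.
Proof.
move=> fg v; rewrite [v]row_sum_delta !linear_sum.
by apply: eq_bigr => i _; rewrite !linearZ /= fg.
Qed.

Lemma rV_lift A B n (g : {linear A -> B}) (f : {linear 'rV[R]_n -> B}) :
  (forall b, exists a, g a = b) ->
  exists h : {linear 'rV[R]_n -> A}, forall v, g (h v) = f v.
Proof.
move=> gs; have [y yP] := choice (fun i : 'I_n => gs (f 'e_i)).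
exists (lincomb y).
apply: (@rV_linear_ext B n (g \o lincomb y : {linear _ -> _})) => i.
by rewrite -yP; congr (g _); apply: lincomb_delta.
Qed.


(** * Finitely generated and finitely presented modules *)

Section Spans.
Variable V : lmodType R.

Fixpoint in_span (s : seq V) (x : V) : Prop :=
  if s is y :: s' then exists r, in_span s' (x - r *: y) else x = 0.

Lemma submodP_span s : submodP (in_span s).
Proof.
elim: s => [|y s [IH0 IHl]] /=.
  by split=> // a x y -> ->; rewrite scaler0 addr0.
split; first by exists 0; rewrite scale0r subr0.
move=> a x x' [r xs] [r' xs']; exists (a * r + r').
have -> : a *: x + x' - (a * r + r') *: y =
          a *: (x - r *: y) + (x' - r' *: y); last exact: IHl.
by rewrite scalerBr scalerA scalerDl opprD addrACA.
Qed.

Lemma span_min (P : V -> Prop) s :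
  submodP P -> (forall y, y \in s -> P y) -> forall x, in_span s x -> P x.
Proof.
move=> [P0 Pl]; elim: s => [|y s IH] sP x /=; first by move=> ->.
move=> [r xs]; rewrite -(subrK (r *: y) x) addrC; apply: Pl.
  by apply: sP; rewrite mem_head.
by apply: IH => // z zs; apply: sP; rewrite inE zs orbT.
Qed.

Lemma mem_span s y : y \in s -> in_span s y.
Proof.
elim: s => //= z s IH; rewrite inE => /orP[/eqP ->|ys].
  by exists 1; rewrite scale1r subrr; case: (submodP_span s).
by exists 0; rewrite scale0r subr0; apply: IH.
Qed.

Lemma span_rV s : exists q : {linear 'rV[R]_(size s) -> V},
  forall x, in_span s x <-> exists w, q w = x.
Proof.
exists (lincomb (fun i => nth 0 s i)) => x; split.
  apply: (span_min (submodP_image _)) => y ys.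
  have iy : (index y s < size s)%N by rewrite index_mem.
  exists 'e_(Ordinal iy); apply: etrans (lincomb_delta _ _) _.
  by rewrite /= nth_index.
move=> [w <-]; rewrite /= /lincomb_fun; have [s0 sl] := submodP_span s.
elim/big_rec: _ => // i z _; apply: sl.
by apply/mem_span/mem_nth.
Qed.

End Spans.

Lemma rV_span n : exists s : seq 'rV[R]_n, forall v, in_span s v.
Proof.
exists [seq 'e_i | i <- enum 'I_n] => v; rewrite [v]row_sum_delta.
have [s0 sl] := submodP_span [seq ('e_i : 'rV[R]_n) | i <- enum 'I_n].
elim/big_rec: _ => // i z _; apply: sl.
by apply: mem_span; apply: map_f; rewrite mem_enum.
Qed.

Lemma fin_presented_rV n : fin_presented 'rV[R]_n.
Proof.
exists 0%N, n, (\0 : {linear 'rV[R]_0 -> 'rV[R]_n}).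
exists (idfun : {linear 'rV[R]_n -> 'rV[R]_n}).
split=> [v|v]; first by exists v.
by split=> [/= -> | [_ <-] //]; exists 0.
Qed.

Lemma fin_presented_coker m n (q : {linear 'rV[R]_m -> 'rV[R]_n}) :
  fin_presented (quot_mod (image_mod q)).
Proof.
exists m, n, q, (sub_proj (image_mod q)); split; first exact: quot_surj.
by move=> v; split=> [/quot_pi_eq0/comprehensionE //|qv];
   apply/quot_pi_eq0/comprehensionE.
Qed.

Lemma fin_presented_generated (A : lmodType R) :
  fin_presented A -> fin_generated A.
Proof. by move=> [m [n [q [p [ps _]]]]]; exists n, p. Qed.

Lemma fin_presented_iso (A B : lmodType R) (f : {linear A -> B}) :
  injective f -> (forall b, exists a, f a = b) ->
  fin_presented A -> fin_presented B.
Proof.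
move=> fi fs [m [n [q [p [ps pq]]]]].
exists m, n, q, (f \o p : {linear 'rV[R]_n -> B}); split=> [b|v].
  by have [a <-] := fs b; have [v <-] := ps a; exists v.
rewrite -pq; split=> [/= e|/= ->]; last exact: linear0.
by apply: fi; rewrite e linear0.
Qed.

Lemma fin_presented0 (A : lmodType R) : (forall a : A, a = 0) -> fin_presented A.
Proof.
move=> A0; apply: (@fin_presented_iso 'rV[R]_0 A \0); last exact: fin_presented_rV.
- by move=> x y _; apply/rowP => -[].
- by move=> b; exists 0; rewrite (A0 b).
Qed.

(** * Pure epimorphisms *)

Definition pure_epi V W (g : {linear V -> W}) : Prop :=
  forall A : lmodType R, fin_presented A -> forall w : {linear A -> W},
    exists v : {linear A -> V}, forall a, g (v a) = w a.

Lemma pure_epi_surj V W (g : {linear V -> W}) :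
  pure_epi g -> forall w, exists v, g v = w.
Proof.
move=> gp w; have [h hP] := gp _ (fin_presented_rV 1) (lincomb (fun=> w)).
by exists (h 'e_0); rewrite hP; apply: lincomb_delta.
Qed.

(** * Modules over a left noetherian ring *)

Section Noetherian.
Hypothesis Rnoeth : left_noetherian R.

(** If no finite sequence spans I, then a choice of elements of I outside the
    spans of the previous ones gives an ascending chain that does not stop. *)
Lemma left_ideal_span (I : submodClosed R^o) :
  exists s : seq R^o, forall x, x \in I <-> in_span s x.
Proof.
apply: contrapT => noS.
have cE s : exists c : R^o,
    (forall y, y \in s -> y \in I) -> c \in I /\ ~ in_span s c.
  apply: contrapT => noc; apply: noS; exists s => x.
  have sI : forall y, y \in s -> y \in I.
    by apply: contrapT => sI; apply: noc; exists 0 => /sI.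
  split; last exact: (span_min (submodP_mem I)).
  move=> xI; apply: contrapT => xs; apply: noc; by exists x.
have [c cP] := choice cE.
pose g n := iter n (fun s => c s :: s) [::].
have gI n : forall y, y \in g n -> y \in I.
  elim: n => // n IH y; rewrite inE => /orP[/eqP ->|/IH //].
  by case: (cP _ IH).
have [|n nP] := Rnoeth (I := fun n => comprehension (submodP_span (g n))).
  move=> n x /comprehensionE gx; apply/comprehensionE => /=.
  by exists 0; rewrite scale0r subr0.
have [_] := cP _ (gI n); apply; apply/(comprehensionE (submodP_span (g n))).
rewrite -(nP n.+1) //; apply/comprehensionE.
by apply: mem_span; rewrite mem_head.
Qed.

(** Hilbert's argument, one generator at a time: the coefficients at y of
    the elements of S form a left ideal; finitely many elements of S realize
    its generators, and they generate S modulo the part of S that lies in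
    the span of the other generators. *)
Lemma noetherian_span V (s : seq V) (S : submodClosed V) :
  (forall x, x \in S -> in_span s x) ->
  exists t : seq V, forall x, x \in S <-> in_span t x.
Proof.
elim: s S => [|y s IH] S sS.
  by exists [::] => x; split=> [/sS //|/= ->]; apply: rpred0.
have IP : @submodP R^o (fun r : R => exists2 x : V, x \in S & in_span s (x - r *: y)).
  have [s0 sl] := submodP_span s; split.
    by exists 0; [exact: rpred0 | rewrite scale0r subr0].
  (* scaling on R^o is the product of R *)
  move=> a; change (forall r r' : R, (exists2 x : V, x \in S & in_span s (x - r *: y)) ->
    (exists2 x : V, x \in S & in_span s (x - r' *: y)) ->
    exists2 x : V, x \in S & in_span s (x - (a * r + r') *: y)).
  move=> r r' [x xS xs] [x' xS' xs']; exists (a *: x + x').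
    by apply: rpredD => //; apply: rpredZ.
  have -> : a *: x + x' - (a * r + r') *: y =
            a *: (x - r *: y) + (x' - r' *: y); last exact: sl.
  by rewrite scalerBr scalerA scalerDl opprD addrACA.
have [rs rsP] := left_ideal_span (comprehension IP).
have SP : submodP (fun x => x \in S /\ in_span s x).
  have [[S0 Sl] [s0 sl]] := (submodP_mem S, submodP_span s).
  by split=> // a x x' [xS xs] [xS' xs']; split; [apply: Sl | apply: sl].
have [|t tP] := IH (comprehension SP); first by move=> x /comprehensionE[].
have [u uS uP] : exists2 u : seq V, forall x : V, x \in u -> x \in S &
    forall r : R, @in_span R^o rs r -> exists2 x, in_span u x & in_span s (x - r *: y).
  have: forall r : R, r \in rs -> exists2 x, x \in S & in_span s (x - r *: y).
    by move=> r rrs; apply/(comprehensionE IP)/rsP/mem_span.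
  elim: (rs) => [_|r rs' IH' rsS].
    exists [::] => // r ->; exists 0 => //.
    by rewrite scale0r subr0; case: (submodP_span s).
  have [|u uS uP] := IH'.
    by move=> r' r'rs; apply: rsS; rewrite inE r'rs orbT.
  have [x xS xs] := rsS r (mem_head _ _).
  exists (x :: u) => [z|z /= [a /uP[z' z'u z's]]].
    by rewrite inE => /orP[/eqP ->|/uS].
  exists (a *: x + z'); first by exists a; rewrite addrAC subrr add0r.
  have [s0 sl] := submodP_span s.
  have -> : a *: x + z' - z *: y =
    a *: (x - (r : R) *: y) + (z' - (z - a * r) *: y); last exact: sl.
  rewrite scalerBr scalerA scalerBl opprB !addrA.
  by rewrite (addrAC (a *: x) _ z') subrK.
exists (t ++ u) => x; split=> [xS|].
  have [r xs] := sS x xS.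
  have [|x' x'u x's] := uP r; first by apply/rsP/comprehensionE; exists x.
  have [s0 sl] := submodP_span s; have [tu0 tul] := submodP_span (t ++ u).
  have tuS z : z \in t ++ u -> in_span (t ++ u) z by exact: mem_span.
  rewrite -(subrK x' x) -[x - x']scale1r; apply: tul.
    apply: (@span_min _ _ t (submodP_span (t ++ u))).
      by move=> z zt; apply: mem_span; rewrite mem_cat zt.
    apply/tP/comprehensionE; split.
      by apply: submodB => //; apply: (span_min (submodP_mem S)) x'u.
    have -> : x - x' = -1 *: (x' - r *: y) + (x - r *: y); last exact: sl.
    by rewrite scaleN1r opprB [RHS]addrC addrA subrK.
  apply: (@span_min _ _ u (submodP_span (t ++ u))) x'u => z zu.
  by apply: mem_span; rewrite mem_cat zu orbT.
apply: (span_min (submodP_mem S)) => z.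
rewrite mem_cat => /orP[zt|/uS //].
by have /tP/comprehensionE[] := mem_span zt.
Qed.

Lemma noetherian_fin_presented (A : lmodType R) :
  fin_generated A -> fin_presented A.
Proof.
move=> [n [p ps]]; have [s sP] := rV_span n.
have [t tP] := @noetherian_span _ s (kernel p) (fun x _ => sP x).
have [q qP] := span_rV t.
exists (size t), n, q, p; split=> // v.
by rewrite -qP -tP kernelP.
Qed.

End Noetherian.

End LinearTools.

(** * Pure epimorphisms out of projective modules *)

Section Projective.
Variable R : pzRingType.

(** A section of the free module on the set Q has finitely many nonzero
    coordinates at x.  The free module is replaced by a module G of pairs (f, q)
    where f : Q -> R is a family of coefficients that sums up to q over every
    large enough finite set. *)
Lemma projective_dual_basis (Q : lmodType R) (x : Q) : projective_mod Q ->
  exists n (f : 'I_n -> {linear Q -> R^o}) (q : 'I_n -> Q),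
    x = \sum_i (f i x : R) *: q i.
Proof.
move=> projQ.
pose G (z : ((Q -> R^o) * Q)%type) := exists s : seq Q, forall t : seq Q,
  uniq t -> {subset s <= t} -> z.2 = \sum_(y <- t) (z.1 y : R) *: y.
have GP : submodP G.
  split.
    by exists [::] => t _ _; rewrite big1 // => y _; rewrite scale0r.
  move=> a z z' [s sP] [s' s'P]; exists (s ++ s') => t ut st.
  rewrite /= (sP t) //; last by move=> y ys; apply: st; rewrite mem_cat ys.
  rewrite (s'P t) //; last by move=> y ys; apply: st; rewrite mem_cat ys orbT.
  rewrite scaler_sumr -big_split; apply: eq_bigr => y _ /=.
  by rewrite scalerA -scalerDl.
have gl : linear (fun u : submod_of (comprehension GP) => (val u).2) by [].
have [|h hP] := projQ _ _ (lin_of gl) (idfun : {linear Q -> Q}).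
  move=> q; have Gq : G ((fun y => (y == q)%:R), q).
    exists [:: q] => t ut qt; rewrite (bigD1_seq q) ?qt ?inE //= eqxx scale1r.
    by rewrite big1 ?addr0 // => y /negPf ->; rewrite scale0r.
  by move/(comprehensionE GP): Gq => Gq; exists (to_sub Gq).
have fl (y : Q) : linear (fun z => (sub_incl (comprehension GP) (h z)).1 y : R^o).
  by move=> a z z'; rewrite (linearP h) (linearP (sub_incl _)).
have /(comprehensionE GP)[s sP] := valP (h x).
exists (size (undup s)), (fun i => lin_of (fl (tnth (in_tuple (undup s)) i))).
exists (fun i => tnth (in_tuple (undup s)) i).
rewrite -[LHS]hP [LHS](sP (undup s)) ?undup_uniq //; first by rewrite big_tnth.
by move=> y; rewrite mem_undup.
Qed.

(** The coordinates of x are a relation between the images of the dual basis.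
    They define a finitely presented module; lifting its map to W moves each
    basis vector into the kernel without changing the value at x. *)
Lemma pure_kernel_fix (Q W : lmodType R) (g : {linear Q -> W}) (x : Q) :
  projective_mod Q -> pure_epi g -> g x = 0 ->
  exists2 phi : {linear Q -> Q}, phi x = x & forall z, g (phi z) = 0.
Proof.
move=> projQ gp gx0; have [n [f [q xE]]] := projective_dual_basis x projQ.
pose r : 'rV[R]_n := \row_i f i x.
pose rel : {linear 'rV[R]_1 -> 'rV[R]_n} := lincomb (fun=> r).
have [||w wP] := @factor_surj R _ _ W (sub_proj (image_mod rel))
  (lincomb (fun i => g (q i))).
- exact: quot_surj.
- move=> v /quot_pi_eq0/comprehensionE[c <-].
  rewrite [rel c]/= /lincomb_fun big_ord1 linearZ /=.
  suff -> : lincomb_fun (fun i => g (q i)) r = 0 by rewrite scaler0.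
  rewrite -[RHS]gx0 [in RHS]xE linear_sum; apply: eq_bigr => i _.
  by rewrite mxE linearZ.
have [v vP] := gp _ (fin_presented_coker rel) w.
pose k i := q i - v (quot_pi _ 'e_i).
have phil : linear (fun z => \sum_i (f i z : R) *: k i).
  move=> a y z; rewrite scaler_sumr -big_split; apply: eq_bigr => i _ /=.
  by rewrite linearP scalerDl scalerA.
exists (lin_of phil) => [|z] /=.
  rewrite /k; under eq_bigr do rewrite scalerBr.
  rewrite sumrB -xE; apply/eqP; rewrite subr_eq -{1}[x]addr0; apply/eqP.
  congr (_ + _); apply/esym.
  transitivity (v (quot_pi (image_mod rel) r)); last first.
    rewrite (_ : quot_pi _ r = 0) ?linear0 //; apply/quot_pi_eq0.
    apply/comprehensionE; exists 'e_0; exact: lincomb_delta.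
  rewrite [X in quot_pi _ X](row_sum_delta r) !linear_sum.
  by apply: eq_bigr => i _; rewrite mxE !linearZ.
rewrite linear_sum big1 // => i _; rewrite linearZ /= linearB vP.
have := wP 'e_i; rewrite /sub_proj /= => ->.
have /= -> := lincomb_delta (fun i => g (q i)) i.
by rewrite subrr scaler0.
Qed.

(** Nakayama: an endomorphism phi with values in a superfluous submodule makes
    1 - phi surjective, hence split, and its kernel, which consists of fixed
    points of phi, is both superfluous and a direct summand, hence zero. *)
Lemma superfluous_pure_kernel (Q W : lmodType R) (p : {linear Q -> W}) :
  projective_cover p -> pure_epi p -> injective p.
Proof.
move=> [projQ ps psup] pp; apply: linear_inj => x px.
have [phi phix pphi] := pure_kernel_fix projQ pp px.
have [e eE] : exists e : {linear Q -> Q}, forall z, e z = z - phi z.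
  by exists (idfun \- phi).
have [|s sP] := projQ _ _ e (idfun : {linear Q -> Q}).
  move=> z.
  have [|u eu] := (comprehensionE (submodP_image e) z).1 _; last by exists u.
  apply: psup => {}z; exists (phi z), (e z); split; last by rewrite eE addrC subrK.
    by apply/kernelP; apply: pphi.
  by apply/comprehensionE; exists z.
have /comprehensionE[y yx] : x \in image_mod s.
  apply: psup => z; exists (z - s (e z)), (s (e z)); rewrite subrK; split=> //.
    have ez : e (z - s (e z)) = 0 by rewrite linearB /= sP subrr.
    by apply/kernelP; move/eqP: ez; rewrite eE subr_eq0 => /eqP ->.
  by apply/comprehensionE; exists (e z).
have: e x = 0 by rewrite eE phix subrr.
by rewrite -yx sP /= => ->; rewrite linear0.
Qed.

(** As V is projective, g factors through the cover p, so p is a pure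
    epimorphism as well, hence an isomorphism; so W is projective. *)
Lemma cover_pure_epi_split (V W Q : lmodType R) (g : {linear V -> W})
    (p : {linear Q -> W}) :
  projective_mod V -> pure_epi g -> projective_cover p ->
  exists s : {linear W -> V}, forall w, g (s w) = w.
Proof.
move=> projV gp pc; have [projQ ps psup] := pc.
have [h hP] := projV _ _ p g ps.
have pp : pure_epi p.
  move=> A fpA w; have [v vP] := gp A fpA w.
  by exists (h \o v : {linear A -> Q}) => a /=; rewrite hP vP.
(* k is the inverse of p *)
have [k kP] := factor_inj (f := idfun : {linear W -> W})
  (superfluous_pure_kernel pc pp) ps.
have [u uP] := projQ _ _ g p (pure_epi_surj gp).
by exists (u \o k : {linear W -> V}) => w /=; rewrite uP kP.
Qed.

End Projective.

(** * Pure epimorphisms out of injective modules *)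

Section Injective.
Variable R : pzRingType.

(** Linear partial maps are encoded by their graphs. *)
Definition partial_extension (A B N : lmodType R) (g : {linear A -> B})
    (f : {linear A -> N}) (G : B * N -> Prop) : Prop :=
  [/\ submodP G, forall n, G (0, n) -> n = 0 & forall a, G (g a, f a)].

(** Zorn's lemma for the partial linear maps B -> N that extend f along g. *)
Lemma maximal_partial_extension (A B N : lmodType R) (g : {linear A -> B})
    (f : {linear A -> N}) : injective g ->
  exists2 G, partial_extension g f G & forall G' : B * N -> Prop,
    partial_extension g f G' -> (forall z, G z -> G' z) -> forall z, G' z -> G z.
Proof.
move=> gi; pose T := {G : B * N -> Prop | partial_extension g f G}.
have t0 : partial_extension g f (fun z => exists a, z = (g a, f a)).
  split; last by move=> a; exists a.
    split; first by exists 0; rewrite !linear0.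
    by move=> a _ _ [x ->] [y ->]; exists (a *: x + y); rewrite !linearP.
  by move=> n [a [ga ->]]; rewrite (gi a 0) ?linear0.
pose le (G G' : T) := `[< forall z, sval G z -> sval G' z >].
have [||C Ctot|[G GP] Gmax] := @ZL_preorder T (exist _ _ t0) le.
- by move=> G; apply/asboolP.
- move=> G G' G'' /asboolP GG' /asboolP G'G''; apply/asboolP => z /GG'.
  exact: G'G''.
- have [[G0 CG0]|C0] := pselect (exists G, C G); last first.
    by exists (exist _ _ t0) => G CG; case: C0; exists G.
  have UP : partial_extension g f (fun z => exists2 G, C G & sval G z).
    split.
    + split; first by exists G0 => //; case: (svalP G0) => -[].
      move=> a z z' [G CG Gz] [G' CG' Gz'].
      have [/asboolP GG'|/asboolP G'G] := Ctot _ _ CG CG'.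
        by exists G' => //; have [[_ l] _ _] := svalP G'; apply: l => //; apply: GG'.
      by exists G => //; have [[_ l] _ _] := svalP G; apply: l => //; apply: G'G.
    + by move=> n [G _]; have [_ G0' _] := svalP G; apply: G0'.
    + by move=> a; exists G0 => //; have [_ _] := svalP G0; apply.
  by exists (exist _ _ UP) => G CG; apply/asboolP => z Gz /=; exists G.
exists G => // G' G'P GG' z G'z.
have /asboolP := Gmax (exist _ _ G'P) (asboolT GG').
by apply.
Qed.

(** Baer's criterion, with the extension of maps from left ideals in the form
    in which it is used: the values of such a map are multiples of one element. *)
Lemma baer_criterion (N : lmodType R) :
  (forall (I : submodClosed R^o) (f : {linear submod_of I -> N}),
     exists n, forall r : submod_of I, f r = (val r : R) *: n) ->
  injective_mod N.
Proof.
move=> NI A B g f gi.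
have [G [GP G0 Gf] Gmax] := @maximal_partial_extension A B N g f gi.
suff Gtot b : exists n, G (b, n).
  have [||h hP] := @linear_of_graph R B N (fun b n => G (b, n)) Gtot.
  - by move=> a x y x' y' Gx Gy; apply: (GP.2 a _ _ Gx Gy).
  - exact: G0.
  - by exists h => a; apply/esym/hP.
have IP : @submodP R R^o (fun r : R => exists n, G (r *: b, n)).
  split; first by exists 0; rewrite scale0r; case: GP.
  (* scaling on R^o is the product of R *)
  move=> a; change (forall r r' : R, (exists n, G (r *: b, n)) ->
    (exists n, G (r' *: b, n)) -> exists n, G ((a * r + r') *: b, n)).
  move=> r r' [n Gn] [n' Gn']; exists (a *: n + n').
  by rewrite scalerDl -scalerA; apply: (GP.2 a _ _ Gn Gn').
have [|||h hP] := @linear_of_graph R (submod_of (comprehension IP)) N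
  (fun r n => G ((val r : R) *: b, n)).
- by move=> r; apply/(comprehensionE IP)/(valP r).
- move=> a x y x' y' Gx Gy; rewrite linearP.
  have -> : ((a *: (val x : R^o) + val x' : R^o) : R) *: b
          = a *: ((val x : R) *: b) + (val x' : R) *: b.
    by rewrite scalerDl -scalerA.
  exact: (GP.2 a _ _ Gx Gy).
- by move=> n; rewrite linear0 scale0r; apply: G0.
have [n0 n0P] := NI _ h.
have Gn0 (r : R) n : G (r *: b, n) -> n = r *: n0.
  move=> Grn; have rI : (r : R^o) \in comprehension IP.
    by apply/comprehensionE; exists n.
  by have /hP := Grn : G ((val (to_sub rI) : R) *: b, n); rewrite n0P.
exists n0; apply: (Gmax (fun z => exists (r : R) c m,
  G (c, m) /\ z = (c + r *: b, m + r *: n0))).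
- split.
  + split.
      by exists 0, 0, 0; rewrite !scale0r !addr0; case: GP.
    move=> a _ _ [r [c [m [Gc ->]]]] [r' [c' [m' [Gc' ->]]]].
    exists (a * r + r'), (a *: c + c'), (a *: m + m'); split.
      exact: (GP.2 a _ _ Gc Gc').
    by congr (_, _); rewrite /= scalerDr scalerA scalerDl addrACA.
  + move=> n [r [c [m [Gc [/esym/eqP ce ->]]]]].
    move: ce; rewrite addr_eq0 -scaleNr => /eqP ce.
    by rewrite (Gn0 (- r) m) -?ce // scaleNr addNr.
  + by move=> a; exists 0, (g a), (f a); rewrite !scale0r !addr0.
- by move=> [c m] Gc; exists 0, c, m; rewrite !scale0r !addr0.
- by exists 1, 0, 0; rewrite !scale1r !add0r; case: GP.
Qed.

(** For a left ideal I the module R/I is finitely presented: a map I -> ker g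
    is multiplication by some e in E, and the resulting map R/I -> W lifts to
    E, which allows e to be corrected to an element of ker g. *)
Lemma pure_kernel_injective (E W : lmodType R) (g : {linear E -> W}) :
  left_noetherian R -> injective_mod E -> pure_epi g ->
  injective_mod (submod_of (kernel g)).
Proof.
move=> Rn injE gp; apply: baer_criterion => I f.
have [|h hP] := injE _ _ (sub_incl I) (sub_incl (kernel g) \o f : {linear _ -> E}).
  exact: val_inj.
pose e := h 1.
have hE (r : R) : h r = r *: e by apply: linear_regular.
have fe r : val (f r) = (val r : R) *: e by rewrite -hE -[LHS]/((_ \o f) r) -hP.
have [||w wP] := factor_surj (g := sub_proj I) (f := g \o h : {linear R^o -> W}).
- exact: quot_surj.
- move=> r /quot_pi_eq0 rI /=; rewrite hE -(fe (to_sub rI)).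
  exact/kernelP/(valP (f _)).
have fgI : fin_generated (quot_mod I).
  exists 1%N, (lincomb (fun=> quot_pi I 1)) => z; exists (const_mx (quot_repr z : R)).
  rewrite /= /lincomb_fun big_ord1 mxE -(linear_regular (sub_proj I)).
  exact: quot_reprK.
have [v vP] := gp _ (noetherian_fin_presented Rn fgI) w.
have nP : e - v (quot_pi I 1) \in kernel g.
  by apply/kernelP; rewrite linearB vP [w _]wP subrr.
exists (to_sub nP) => r; apply: val_inj.
rewrite linearZ fe /= scalerBr -(linear_regular (v \o sub_proj I)) /=.
rewrite (_ : quot_pi I _ = 0) ?linear0 ?oppr0 ?addr0 //.
by apply/quot_pi_eq0/(valP r).
Qed.

End Injective.

(** * Classes of modules in which pure epimorphisms split *)

Section SplittingClasses.
Variable R : pzRingType.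

Definition pure_split_class (C : lmodType R -> Prop) : Prop :=
  (forall (V K : lmodType R) (i : {linear K -> V}) (r : {linear V -> K}),
     (forall x, r (i x) = x) -> C V -> C K) /\
  (forall (V W : lmodType R) (g : {linear V -> W}), C V -> pure_epi g ->
     exists s : {linear W -> V}, forall w, g (s w) = w).

Lemma projective_retract (V K : lmodType R) (i : {linear K -> V})
    (r : {linear V -> K}) :
  (forall x, r (i x) = x) -> projective_mod V -> projective_mod K.
Proof.
move=> ri projV A B g f gs.
have [h hP] := projV A B g (f \o r : {linear V -> B}) gs.
by exists (h \o i : {linear K -> A}) => x; rewrite /= hP /= ri.
Qed.

Lemma injective_retract (V K : lmodType R) (i : {linear K -> V})
    (r : {linear V -> K}) :
  (forall x, r (i x) = x) -> injective_mod V -> injective_mod K.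
Proof.
move=> ri injV A B g f gi.
have [h hP] := injV A B g (i \o f : {linear A -> V}) gi.
by exists (r \o h : {linear B -> K}) => x; rewrite /= hP /= ri.
Qed.

Lemma fin_generated_image (V K : lmodType R) (r : {linear V -> K}) :
  (forall y, exists x, r x = y) -> fin_generated V -> fin_generated K.
Proof.
move=> rs [n [p ps]]; exists n, (r \o p : {linear _ -> K}) => y.
by have [x <-] := rs y; have [v <-] := ps x; exists v.
Qed.

Lemma retract_surj (V K : lmodType R) (i : {linear K -> V}) (r : {linear V -> K}) :
  (forall x, r (i x) = x) -> forall y, exists x, r x = y.
Proof. by move=> ri y; exists (i y). Qed.

Lemma injective_split_class :
  left_noetherian R -> pure_split_class (@injective_mod R).
Proof.
move=> Rn; split=> [|V W g injV gp]; first exact: injective_retract.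
have [r rP] := pure_kernel_injective Rn injV gp idfun
  (val_inj : injective (sub_incl (kernel g))).
have [||s sP] := @factor_surj R V W V g
  ((idfun : {linear V -> V}) \- (sub_incl (kernel g) \o r)).
- exact: pure_epi_surj gp.
- move=> v /kernelP gv /=; apply/eqP; rewrite subr_eq0; apply/eqP.
  by rewrite (rP (to_sub gv) : r v = to_sub gv).
exists s => w; have [v <-] := pure_epi_surj gp w.
by rewrite sP linearB /= (kernelP g (val (r v))).1 ?subr0 //; apply: valP.
Qed.

Lemma projective_split_class :
  left_perfect R -> pure_split_class (@projective_mod R).
Proof.
move=> Rp; split=> [|V W g projV gp]; first exact: projective_retract.
by have [Q [p pc]] := Rp W; apply: cover_pure_epi_split pc.
Qed.

Definition fg_projective (V : lmodType R) : Prop :=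
  fin_generated V /\ projective_mod V.

Lemma fg_projective_retract (V K : lmodType R) (i : {linear K -> V})
    (r : {linear V -> K}) :
  (forall x, r (i x) = x) -> fg_projective V -> fg_projective K.
Proof.
move=> ri [fgV projV]; split; last exact: projective_retract projV.
exact: fin_generated_image (retract_surj ri) fgV.
Qed.

Lemma fg_projective_split_class_semi_perfect :
  semi_perfect R -> pure_split_class fg_projective.
Proof.
move=> Rsp; split=> [|V W g [fgV projV] gp]; first exact: fg_projective_retract.
have [Q [p pc]] := Rsp W (fin_generated_image (pure_epi_surj gp) fgV).
exact: cover_pure_epi_split pc.
Qed.

Lemma fg_projective_split_class_noetherian :
  left_noetherian R -> pure_split_class fg_projective.
Proof.
move=> Rn; split=> [|V W g [fgV _] gp]; first exact: fg_projective_retract.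
apply: (gp W _ idfun); apply: noetherian_fin_presented => //.
exact: fin_generated_image (pure_epi_surj gp) fgV.
Qed.

End SplittingClasses.

(** * Families indexed by the integers *)

Lemma dependent_choice_fun (I : Type) (T : I -> Type) (Q : forall i, T i -> Prop) :
  (forall i, exists x, Q i x) -> exists g : forall i, T i, forall i, Q i (g i).
Proof. by move=> H; exists (fun i => sval (cid (H i))) => i; case: cid. Qed.

(** The differential out of degree i + 1 makes formulas available in degrees of
    the form i + 1 only.  Every degree has this form, and the transports that
    this requires are confined to [family_from_succ] and [family_two_values]. *)
Lemma family_from_succ (T : int -> Type) (f : forall i, T (i + 1)) :
  exists g : forall i, T i, forall i, g (i + 1) = f i.
Proof.
exists (fun j => eq_rect _ T (f (j - 1)) _ (subrK 1 j)) => i.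
move: (i + 1 - 1) (subrK 1 (i + 1)) => k e.
have ki : k = i by apply: (addIr (1 : int)).
subst k.
by rewrite (eq_irrelevance e erefl).
Qed.

Lemma succ_neq (k : int) : k <> k + 1.
Proof. by apply/eqP; rewrite lt_eqF // ltrDl. Qed.

Lemma family_two_values (T : int -> Type) (z : forall j, T j) k
    (a : T (k + 1)) (b : T k) :
  exists F : forall j, T j,
    [/\ F (k + 1) = a, F k = b & forall j, j <> k -> j <> k + 1 -> F j = z j].
Proof.
exists (fun j => match pselect (j = k + 1), pselect (j = k) with
  | left e, _ => eq_rect _ T a _ (esym e)
  | _, left e => eq_rect _ T b _ (esym e)
  | _, _ => z j end).
split.
- by case: pselect => // e; rewrite (eq_irrelevance e erefl).
- case: pselect => [e|_]; first by have := succ_neq e.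
  by case: pselect => // e; rewrite (eq_irrelevance e erefl).
- by move=> j jk jk1; case: pselect => // _; case: pselect.
Qed.

(** * Purity of short exact sequences and of subcomplexes *)

Section Purity.
Variable R : pzRingType.

Definition pure_epi_cx (M N : complex R) (g : chain_map M N) : Prop :=
  forall A : complex R, bounded A -> (forall i, fin_presented (A i)) ->
  forall w : chain_map A N, exists v : chain_map A M, eq_chain (comp_chain g v) w.

(** The complexes Hom(A, C) are acyclic for all finitely presented A: this is
    pure-acyclicity without reference to the modules of cycles. *)
Definition hom_acyclic (C : complex R) : Prop :=
  forall A : lmodType R, fin_presented A -> forall i (w : {linear A -> C (i + 1)}),
    (forall a, cx_d C i (w a) = 0) ->
    exists v : {linear A -> C (i + 1 + 1)}, forall a, cx_d C (i + 1) (v a) = w a.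

(** The functors Hom(A, -) are left exact, so that purity is a matter of
    lifting maps along the epimorphism; likewise for complexes. *)
Lemma hom_exact_of_lift (A L M N : lmodType R) (f : {linear L -> M})
    (g : {linear M -> N}) : short_exact f g ->
  (forall w : {linear A -> N}, exists v : {linear A -> M}, forall a, g (v a) = w a) ->
  hom_exact A f g.
Proof.
move=> [fi fg gs] lift; split=> [u u' uu' a|v|w].
- exact: fi (uu' a).
- split=> [gv|[u uv] a].
    by have [|u uP] := factor_inj (f := v) fi; [move=> a; apply/fg/gv | exists u].
  by rewrite /= -uv; apply/fg; exists (u a).
- by have [v vP] := lift w; exists v.
Qed.

Lemma hom_exact_cx_of_lift (A L M N : complex R) (f : chain_map L M)
    (g : chain_map M N) : short_exact_cx f g ->
  (forall w : chain_map A N, exists v : chain_map A M, eq_chain (comp_chain g v) w) ->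
  hom_exact_cx A f g.
Proof.
move=> fg lift; split=> [u u' uu' i a|v|//].
  by have [fi _ _] := fg i; apply/fi/(uu' i a).
split=> [gv|[u uv] i a]; last first.
  by rewrite -[LHS]/(g i (v i a)) -uv; have [_ fgi _] := fg i; apply/fgi; exists (u i a).
have /dependent_choice_fun[u uP] : forall i, exists u : {linear A i -> L i},
    forall a, f i (u a) = v i a.
  move=> i; have [fi fgi _] := fg i.
  by apply: (factor_inj fi) => a; apply/fgi/(gv i a).
have uc i x : u i (cx_d A i x) = cx_d L i (u (i + 1) x).
  by have [fi _ _] := fg i; apply: fi; rewrite cm_comm !uP cm_comm.
by exists (ChainMap uc) => i a; apply: uP.
Qed.

Lemma short_exact_subquot (V : lmodType R) (S : submodClosed V) :
  short_exact (sub_incl S) (sub_proj S).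
Proof.
split; [exact: val_inj| |exact: quot_surj].
move=> y; split=> [/quot_pi_eq0 yS|[x <-]]; first by exists (to_sub yS).
by apply/quot_pi_eq0/valP.
Qed.

Lemma pure_subcomplexE (M : complex R) (L : subcomplex M) :
  pure_subcomplex L <-> pure_epi_cx (proj_cx L).
Proof.
split=> [[_ pL] A bA fA|pL]; first by have [_ _] := pL A bA fA.
have se : short_exact_cx (incl_cx L) (proj_cx L).
  by move=> i; apply: short_exact_subquot.
by split=> // A bA fA; apply: hom_exact_cx_of_lift => //; apply: pL.
Qed.

Lemma pure_acyclicE (C : complex R) : pure_acyclic C <-> hom_acyclic C.
Proof.
split=> [[_ pC] A fA i w dw|hC].
  have [_ /(_ A fA)[_ _ lift]] := pC i.
  have wZ a : w a \in cycles C i by apply/kernelP/dw.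
  have [v vP] := lift (cores wZ).
  by exists v => a; have := congr1 val (vP a).
(* R itself is a finitely presented module, and Hom(R, C) is C *)
have aC : acyclic C.
  move=> i y dy; have [|v vP] := hC _ (fin_presented_rV R 1) i (lincomb (fun=> y)).
    by move=> a; rewrite /= /lincomb_fun big_ord1 linearZ /= dy scaler0.
  by exists (v 'e_0); rewrite vP; apply: lincomb_delta.
split=> // i.
have se : short_exact (sub_incl (cycles C (i + 1))) (to_cycles C i).
  split; first exact: val_inj.
    move=> y; split=> [dy|[x <-]]; last by apply: val_inj; apply/kernelP/(valP x).
    have yZ : y \in cycles C (i + 1) by apply/kernelP; have := congr1 val dy.
    by exists (to_sub yZ).
  move=> z; have [|x dx] := aC i (val z); first exact/kernelP/(valP z).
  by exists x; apply: val_inj.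
split=> // A fA; apply: hom_exact_of_lift => // w.
have [|v vP] := hC A fA i (sub_incl (cycles C i) \o w : {linear _ -> _}).
  by move=> a; apply/kernelP/(valP (w a)).
by exists v => a; apply: val_inj; apply: vP.
Qed.

Lemma pure_acyclic_subE (M : complex R) (S : subcomplex M) :
  pure_acyclic (sub_cx S) <->
  forall A : lmodType R, fin_presented A -> forall i (w : {linear A -> M (i + 1)}),
    (forall a, w a \in S (i + 1)) -> (forall a, cx_d M i (w a) = 0) ->
    exists v : {linear A -> M (i + 1 + 1)},
      (forall a, v a \in S (i + 1 + 1)) /\ forall a, cx_d M (i + 1) (v a) = w a.
Proof.
rewrite pure_acyclicE; split=> [hS A fA i w wS dw|hS A fA i w dw].
  have [|v vP] := hS A fA i (cores wS); first by move=> a; apply: val_inj; apply: dw.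
  exists (sub_incl _ \o v : {linear _ -> _}); split=> a; first exact: valP.
  by have := congr1 val (vP a).
have [||v [vS vP]] := hS A fA i (sub_incl _ \o w : {linear A -> M (i + 1)}).
- by move=> a; apply: valP.
- by move=> a; have := congr1 val (dw a).
- by exists (cores vS) => a; apply: val_inj; apply: vP.
Qed.

End Purity.

(** * Disk complexes *)

Section Disk.
Variables (R : pzRingType) (A : lmodType R) (k : int).

(** Each term of the disk is a submodule of A, so that the differential is
    defined without transports between equal degrees. *)
Definition disk_pred (j : int) (x : A) : Prop := j = k \/ j = k + 1 \/ x = 0.

Lemma submodP_disk j : submodP (disk_pred j).
Proof.
split=> [|a x y]; first by right; right.
move=> [->|[->|->]]; [by left|by right; left|].
move=> [->|[->|->]]; [by left|by right; left|right; right].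
by rewrite scaler0 addr0.
Qed.

Definition disk_mod j : lmodType R := submod_of (comprehension (submodP_disk j)).

Definition disk_diff (j : int) : {linear disk_mod (j + 1) -> A} :=
  if j == k then sub_incl _ else \0.

Lemma disk_diff_in j x : disk_diff j x \in comprehension (submodP_disk j).
Proof.
apply/comprehensionE; rewrite /disk_diff.
by case: eqP => [jk|_]; [left | right; right].
Qed.

Definition disk_d j : {linear disk_mod (j + 1) -> disk_mod j} :=
  cores (@disk_diff_in j).

Lemma val_disk_d j x : val (disk_d j x) = if j == k then val x else 0.
Proof. by rewrite /disk_d /= /disk_diff; case: ifP. Qed.

Lemma disk_dd j x : disk_d j (disk_d (j + 1) x) = 0.
Proof.
apply: val_inj; rewrite !val_disk_d; case: eqP => // jk.
by case: eqP => // jk1; case: (@succ_neq j); rewrite jk1.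
Qed.

Definition disk : complex R := Complex disk_dd.

Lemma disk_mod0 j (x : disk_mod j) : j <> k -> j <> k + 1 -> x = 0.
Proof.
move=> jk jk1; apply: val_inj.
by have /comprehensionE[//|[//|]] := valP x.
Qed.

Lemma disk_bounded : bounded disk.
Proof.
exists k, (k + 1) => j jk x; apply: disk_mod0 => jE; move: jk; rewrite jE.
  by rewrite ltxx /= ltNge lerDl ler01.
by rewrite ltxx orbF ltNge lerDl ler01.
Qed.

Lemma disk_fin_presented : fin_presented A -> forall j, fin_presented (disk j).
Proof.
move=> fA j; have [jk|jk] := pselect (j = k \/ j = k + 1); last first.
  by apply: fin_presented0 => x; apply: disk_mod0 => jE; apply: jk; [left|right].
have full x : x \in comprehension (submodP_disk j).
  by apply/comprehensionE; case: jk => jE; [left | right; left].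
apply: (@fin_presented_iso R A (disk j) (cores (f := idfun) full)) fA.
  by move=> x y /(congr1 val).
by move=> b; exists (val b); apply: val_inj.
Qed.

(** The map is w in degree k + 1 and d w in degree k. *)
Lemma disk_map (N : complex R) (w : {linear A -> N (k + 1)}) :
  exists W : chain_map disk N, forall x, W (k + 1) x = w (val x).
Proof.
have [W [W1 W0 WN]] := @family_two_values
  (fun j => {linear disk j -> N j}) (fun=> \0) k
  (w \o sub_incl _) (cx_d N k \o (w \o sub_incl _)).
have Wk j (x : disk j) : j = k -> exists y, W j x = cx_d N j y.
  by move=> jk; subst j; rewrite W0; exists (w (val x)).
suff Wc i x : W i (cx_d disk i x) = cx_d N i (W (i + 1) x).
  by exists (ChainMap Wc) => x; rewrite /= W1.
have [ik|ik] := pselect (i = k).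
  by subst i; rewrite W0 W1 /= /disk_diff eqxx.
have -> : cx_d disk i x = 0.
  by apply: val_inj; rewrite val_disk_d; case: eqP.
rewrite linear0; have [ik1|ik1] := pselect (i + 1 = k).
  by have [y ->] := Wk _ x ik1; rewrite cx_dd.
by rewrite WN ?linear0 // => /(addIr (1 : int)).
Qed.

End Disk.

(** Lift the map of the disk on A in degrees k + 1 and k that extends w, and
    read off its component in degree k + 1. *)
Lemma pure_epi_cx_degree (R : pzRingType) (M N : complex R) (g : chain_map M N) :
  pure_epi_cx g -> forall i, pure_epi (g i).
Proof.
move=> gp i; rewrite -(subrK 1 i); move: (i - 1) => k A fA w.
have [W WP] := disk_map w.
have [V VP] := gp _ (disk_bounded A k) (disk_fin_presented k fA) W.
have full (x : A) : x \in comprehension (submodP_disk A k (k + 1)).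
  by apply/comprehensionE; right; left.
exists (V (k + 1) \o cores (f := idfun) full : {linear A -> M (k + 1)}) => a.
have := VP (k + 1) (cores (f := idfun) full a).
by rewrite WP.
Qed.

(** * Splitting off a contractible subcomplex *)

Section Splitting.
Variable R : pzRingType.

(** The maps C (i + 2) -> Z (i + 1) onto the cycles are pure epimorphisms, and
    sections sig of them give the contraction x |-> sig (x - sig (d x)). *)
Lemma hom_acyclic_contractible (K : lmodType R -> Prop) (C : complex R) :
  pure_split_class K -> (forall i, K (C i)) -> hom_acyclic C -> contractible C.
Proof.
move=> [_ Ksplit] KC hC.
have /dependent_choice_fun[sig sigP] : forall i,
    exists s : {linear submod_of (cycles C i) -> C (i + 1 + 1)},
      forall z, cx_d C (i + 1) (s z) = val z.
  move=> i; have [|s sP] := Ksplit _ _ (to_cycles C i) (KC _).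
    move=> A fA w.
    have [|v vP] := hC A fA i (sub_incl _ \o w : {linear A -> C (i + 1)}).
      by move=> a; apply/kernelP/(valP (w a)).
    by exists v => a; apply: val_inj; apply: vP.
  by exists s => z; have := congr1 val (sP z).
pose e i : {linear C (i + 1 + 1) -> C (i + 1 + 1)} :=
  idfun \- (sig i \o to_cycles C i).
have eZ i x : e i x \in cycles C (i + 1).
  by apply/kernelP; rewrite linearB /= sigP subrr.
(* the component in degree i + 2 of the contraction *)
pose t i : {linear C (i + 1 + 1) -> C (i + 1 + 1 + 1)} :=
  sig (i + 1) \o cores (eZ i).
have [g gP] := @family_from_succ (fun i => {linear C (i + 1) -> C (i + 1 + 1)}) t.
have [s sP] := @family_from_succ (fun i => {linear C i -> C (i + 1)}) g.
exists s => i; rewrite -(subrK 1 i); move: (i - 1) => {}i.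
rewrite -(subrK 1 i); move: (i - 1) => {}i x.
rewrite !sP !gP /t /= sigP /=.
have -> : cores (eZ i) (cx_d C (i + 1 + 1) x) = to_cycles C (i + 1) x.
  apply: val_inj; rewrite /= /e /=.
  have -> : to_cycles C i (cx_d C (i + 1 + 1) x) = 0.
    by apply: val_inj; rewrite /= cx_dd.
  by rewrite linear0 subr0.
by rewrite /e /= subrK.
Qed.

(** With h a contraction of P and r a retraction in each degree, the null
    homotopic map d h r + h r d is a chain map, and it restricts to
    d h + h d = 1 on P. *)
Lemma contractible_retract (M : complex R) (P : subcomplex M) :
  contractible (sub_cx P) ->
  (forall i, exists r : {linear M i -> submod_of (P i)}, forall x, r (val x) = x) ->
  exists r : chain_map M (sub_cx P), forall i x, r i (incl_cx P i x) = x.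
Proof.
move=> [h hP] /dependent_choice_fun[r rP].
pose f i : {linear M (i + 1) -> sub_cx P (i + 1)} :=
  (cx_d (sub_cx P) (i + 1) \o (h (i + 1) \o r (i + 1))) \+
  (h i \o (r i \o cx_d M i)).
have fE i x : f i x = cx_d (sub_cx P) (i + 1) (h (i + 1) (r (i + 1) x))
    + h i (r i (cx_d M i x)) by [].
have [g gP] := @family_from_succ (fun i => {linear M i -> sub_cx P i}) f.
have gc i x : g i (cx_d M i x) = cx_d (sub_cx P) i (g (i + 1) x).
  move: i x => i; rewrite -(subrK 1 i); move: (i - 1) => {}i x.
  by rewrite !gP !fE cx_dd !linear0 addr0 linearD cx_dd add0r.
exists (ChainMap gc) => /= i; rewrite -(subrK 1 i); move: (i - 1) => {}i x.
rewrite gP fE rP [RHS](hP i x); congr (_ + h i _).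
exact: (rP i (sub_d P i x)).
Qed.

(** The section of the projection is induced by 1 - r, and phi = (r, proj). *)
Lemma chain_retract_split (M : complex R) (P : subcomplex M)
    (r : chain_map M (sub_cx P)) :
  (forall i x, r i (incl_cx P i x) = x) ->
  split_cx (incl_cx P) (proj_cx P) /\
  exists phi : chain_map M (dsum (sub_cx P) (quot_cx P)),
    [/\ chain_iso phi,
        forall i x, phi i (incl_cx P i x) = (x, 0%R)
      & forall i x, (phi i x).2 = proj_cx P i x].
Proof.
move=> rP.
have /dependent_choice_fun[s sP] : forall i, exists s : {linear quot_mod (P i) -> M i},
    forall x, s (quot_pi (P i) x) = x - val (r i x).
  move=> i; apply: (@factor_surj R _ _ _ (sub_proj (P i))
    (idfun \- (sub_incl (P i) \o r i))) => [z|x /quot_pi_eq0 xP /=].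
    exact: quot_surj.
  by rewrite [r i x](rP i (to_sub xP)) subrr.
have sc i x : s i (cx_d (quot_cx P) i x) = cx_d M i (s (i + 1) x).
  have [m <-] := quot_surj x.
  by rewrite /= quot_d_pi !sP linearB cm_comm.
have piP i (p : submod_of (P i)) : quot_pi (P i) (val p) = 0.
  by apply/quot_pi_eq0/valP.
have pis i z : quot_pi (P i) (s i z) = z.
  by have [x <-] := quot_surj z; rewrite sP linearB /= [X in _ - X]piP subr0.
have rs i z : r i (s i z) = 0.
  have [x <-] := quot_surj z; rewrite sP linearB.
  by rewrite [r i (val _)](rP i (r i x)) subrr.
split.
  split; first by move=> i; apply: short_exact_subquot.
  by exists (ChainMap sc) => i z; apply: pis.
pose D := dsum (sub_cx P) (quot_cx P).
have phil i : linear (fun x => (r i x, quot_pi (P i) x) : D i).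
  by move=> a x y; rewrite !linearP.
have phic i x : lin_of (phil i) (cx_d M i x) = cx_d D i (lin_of (phil (i + 1)) x).
  by rewrite /= /prod_map_fun /= quot_d_pi cm_comm.
have psil i : linear (fun z : D i => val z.1 + s i z.2 : M i).
  by move=> a x y /=; rewrite !linearP /= scalerDr addrACA.
have psic i z : lin_of (psil i) (cx_d D i z) = cx_d M i (lin_of (psil (i + 1)) z).
  by rewrite /= linearD [s i _]sc.
exists (ChainMap phic); split=> //= [|i x]; last by rewrite [r i _]rP piP.
exists (ChainMap psic); split=> i z /=; first by rewrite sP addrC subrK.
case: z => p q /=; rewrite !linearD rs addr0; congr (_, _); first exact: (rP i p).
exact: etrans (congr2 +%R (piP i p) (pis i q)) (add0r q).
Qed.

Lemma pure_section_retraction (V : lmodType R) (S : submodClosed V)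
    (s : {linear quot_mod S -> V}) :
  (forall z, quot_pi S (s z) = z) ->
  exists r : {linear V -> submod_of S}, forall x, r (val x) = x.
Proof.
move=> sP; have [||r rP] := @factor_inj R _ _ _ (sub_incl S)
  (idfun \- (s \o sub_proj S)).
- exact: val_inj.
- move=> x; have xS : x - s (quot_pi S x) \in S.
    by apply/quot_pi_eq0; rewrite linearB /= sP subrr.
  by exists (to_sub xS).
- exists r => x; apply: val_inj; rewrite [LHS]rP /=.
  rewrite (_ : quot_pi S _ = 0) ?linear0 ?oppr0 ?addr0 //.
  exact/quot_pi_eq0/valP.
Qed.

Lemma pure_subcomplex_split (K : lmodType R -> Prop) (M : complex R)
    (P : subcomplex M) :
  pure_split_class K -> (forall i, K (M i)) ->
  pure_subcomplex P -> pure_acyclic (sub_cx P) ->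
  [/\ split_cx (incl_cx P) (proj_cx P),
      exists phi : chain_map M (dsum (sub_cx P) (quot_cx P)),
        [/\ chain_iso phi,
            forall i x, phi i (incl_cx P i x) = (x, 0%R)
          & forall i x, (phi i x).2 = proj_cx P i x]
    & contractible (sub_cx P)].
Proof.
move=> Ksplit KM /pure_subcomplexE pP /pure_acyclicE aP.
have ret i : exists r : {linear M i -> submod_of (P i)}, forall x, r (val x) = x.
  have [s sP] := Ksplit.2 _ _ _ (KM i) (pure_epi_cx_degree pP (i := i)).
  exact: pure_section_retraction sP.
have cP : contractible (sub_cx P).
  apply: (hom_acyclic_contractible Ksplit) aP => i; have [r rP] := ret i.
  exact: Ksplit.1 (sub_incl (P i)) r rP (KM i).
have [r rP] := contractible_retract cP ret.
by have [? ?] := chain_retract_split rP.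
Qed.

End Splitting.

(** * Maximal pure-acyclic pure subcomplexes *)

Section Maximal.
Variables (R : pzRingType) (M : complex R).

Definition sub_le (L L' : subcomplex M) : Prop :=
  forall i x, x \in L i -> x \in L' i.

Section ZeroSubcomplex.

Lemma submodP_zero (V : lmodType R) : submodP (fun x : V => x = 0).
Proof. by split=> // a x y -> ->; rewrite scaler0 addr0. Qed.

Lemma zero_sub_d i x : x \in comprehension (submodP_zero (M (i + 1))) ->
  cx_d M i x \in comprehension (submodP_zero (M i)).
Proof.
by move=> /comprehensionE ->; apply/comprehensionE; rewrite linear0.
Qed.

Definition zero_sub : subcomplex M := Subcomplex zero_sub_d.

Lemma zero_sub_pure : pure_epi_cx (proj_cx zero_sub).
Proof.
move=> A _ _ w.
have pi_inj i : injective (proj_cx zero_sub i).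
  by apply: linear_inj => x /quot_pi_eq0/comprehensionE.
have /dependent_choice_fun[v vP] : forall i, exists v : {linear A i -> M i},
    forall a, proj_cx zero_sub i (v a) = w i a.
  by move=> i; apply: (factor_inj (@pi_inj i)) => a; apply: quot_surj.
have vc i x : v i (cx_d A i x) = cx_d M i (v (i + 1) x).
  by apply: pi_inj; rewrite vP cm_comm -vP -cm_comm.
by exists (ChainMap vc) => i a; apply: vP.
Qed.

Lemma zero_sub_acyclic : pure_acyclic (sub_cx zero_sub).
Proof.
apply/pure_acyclic_subE => A _ i w w0 _; exists \0; split=> a.
  exact: rpred0.
by rewrite linear0; have /comprehensionE := w0 a.
Qed.

End ZeroSubcomplex.

Section Preimage.
Variables (P : subcomplex M) (L : subcomplex (quot_cx P)).

Lemma submodP_preimage i : submodP (fun x : M i => quot_pi (P i) x \in L i).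
Proof.
have [L0 Ll] := submodP_mem (L i); split; first by rewrite linear0.
by move=> a x y xL yL; rewrite linearP; apply: Ll.
Qed.

Lemma preimage_sub_d i x : x \in comprehension (submodP_preimage (i + 1)) ->
  cx_d M i x \in comprehension (submodP_preimage i).
Proof.
move=> /comprehensionE xL; apply/comprehensionE.
by rewrite -(quot_d_pi P); apply: (sc_d (s := L)).
Qed.

Definition preimage_sub : subcomplex M := Subcomplex preimage_sub_d.

Lemma preimage_subE i x : x \in preimage_sub i <-> quot_pi (P i) x \in L i.
Proof. exact: comprehensionE. Qed.

Lemma preimage_sub_ge : sub_le P preimage_sub.
Proof.
move=> i x xP; apply/preimage_subE.
by rewrite (quot_pi_eq0 (P i) x).2 //; apply: rpred0.
Qed.

(** M modulo the preimage embeds into (M/P)/L, so a map to it can be lifted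
    first to M/P and then to M. *)
Lemma preimage_sub_pure : pure_epi_cx (proj_cx P) ->
  pure_epi_cx (proj_cx L) -> pure_epi_cx (proj_cx preimage_sub).
Proof.
move=> pP pL A bA fA w.
(* th is the isomorphism from M modulo the preimage onto (M/P)/L *)
have /dependent_choice_fun[th thP] : forall i,
    exists th : {linear quot_mod (preimage_sub i) -> quot_mod (L i)},
    forall x, th (quot_pi _ x) = quot_pi (L i) (quot_pi (P i) x).
  move=> i; apply: (factor_surj (g := sub_proj (preimage_sub i))
    (f := sub_proj (L i) \o sub_proj (P i))); first exact: quot_surj.
  by move=> x /quot_pi_eq0/preimage_subE xL; apply/quot_pi_eq0.
have wc i x : (th i \o w i) (cx_d A i x) =
    cx_d (quot_cx L) i ((th (i + 1) \o w (i + 1)) x).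
  rewrite /= cm_comm; have [m <-] := quot_surj (w (i + 1) x).
  have e := quot_d_pi preimage_sub m.
  rewrite [cx_d _ _ _]e !thP.
  have /= -> := quot_d_pi L (quot_pi _ m).
  by have /= -> := quot_d_pi P m.
have [v vP] := pL A bA fA (@ChainMap _ A (quot_cx L) _ wc).
have [u uP] := pP A bA fA v.
exists u => i a; have [m mE] := quot_surj (w i a).
rewrite /= -mE; apply/quot_piP/preimage_subE.
rewrite linearB; apply/quot_piP.
transitivity (quot_pi (L i) (v i a)); first by congr (quot_pi _ _); apply: uP.
by rewrite [LHS](vP i a) /= -mE; apply: thP.
Qed.

(** A cycle w of Hom(A, -) with values in the preimage is a boundary modulo P.
    Purity of P in degree i + 2 lifts the bounding map to M, and the difference
    is a cycle with values in P, hence a boundary. *)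
Lemma preimage_sub_acyclic : pure_epi_cx (proj_cx P) ->
  pure_acyclic (sub_cx P) -> pure_acyclic (sub_cx L) ->
  pure_acyclic (sub_cx preimage_sub).
Proof.
move=> pP /pure_acyclic_subE aP /pure_acyclic_subE aL.
apply/pure_acyclic_subE => A fA i w wS dw.
have [||v [vL dv]] := aL A fA i (sub_proj (P (i + 1)) \o w : {linear _ -> _}).
- by move=> a; apply/preimage_subE/wS.
- by move=> a; rewrite /= quot_d_pi dw linear0.
have [u uP] := pure_epi_cx_degree pP fA v.
have [||z [zP dz]] := aP A fA i (w \- (cx_d M (i + 1) \o u) : {linear A -> M (i + 1)}).
- move=> a; apply/quot_piP; rewrite -[LHS]dv -[RHS](quot_d_pi P).
  by congr (quot_d _ _ _); apply/esym/uP.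
- by move=> a; rewrite /= linearB cx_dd dw subrr.
exists (u \+ z : {linear A -> M (i + 1 + 1)}); split=> a.
  apply: rpredD; last exact/preimage_sub_ge/zP.
  by apply/preimage_subE; rewrite (uP a : quot_pi _ _ = _); apply: vL.
by rewrite linearD dz /= [LHS]addrC subrK.
Qed.

End Preimage.

Section Union.
Variable C : subcomplex M -> Prop.
Hypothesis C_total : forall L L', C L -> C L' -> sub_le L L' \/ sub_le L' L.
Variable L0 : subcomplex M.
Hypothesis CL0 : C L0.

Lemma submodP_union i : submodP (fun x : M i => exists2 L, C L & x \in L i).
Proof.
split; first by exists L0 => //; apply: rpred0.
move=> a x y [L CL xL] [L' CL' yL'].
have [le|le] := C_total CL CL'.
  by exists L' => //; apply: (submodP_mem (L' i)).2 => //; apply: le.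
by exists L => //; apply: (submodP_mem (L i)).2 => //; apply: le.
Qed.

Lemma union_sub_d i x : x \in comprehension (submodP_union (i + 1)) ->
  cx_d M i x \in comprehension (submodP_union i).
Proof.
move=> /comprehensionE[L CL xL]; apply/comprehensionE; exists L => //.
exact: sc_d.
Qed.

Definition union_sub : subcomplex M := Subcomplex union_sub_d.

Lemma union_subE i x : x \in union_sub i <-> exists2 L, C L & x \in L i.
Proof. exact: comprehensionE. Qed.

Lemma union_sub_ge L : C L -> sub_le L union_sub.
Proof. by move=> CL i x xL; apply/union_subE; exists L. Qed.

Lemma union_fin_generated i (V : lmodType R) (s : seq V) (h : {linear V -> M i}) :
  (forall x, in_span s x -> h x \in union_sub i) ->
  exists2 L, C L & forall x, in_span s x -> h x \in L i.
Proof.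
elim: s => [_|y s IH hU].
  by exists L0 => // x ->; rewrite linear0 rpred0.
have [|L CL hL] := IH.
  by move=> x xs; apply: hU; exists 0; rewrite scale0r subr0.
have /union_subE[L' CL' yL'] : h y \in union_sub i.
  by apply/hU/mem_span; rewrite mem_head.
have hE r x : h x = h (x - r *: y) + r *: h y by rewrite -linearZ -linearD subrK.
have [le|le] := C_total CL CL'; [exists L' => //|exists L => //];
  move=> x [r xs]; rewrite (hE r x); apply: rpredD; rewrite ?rpredZ //.
- exact/le/hL.
- exact: hL.
- exact: le.
Qed.

Lemma union_fin_generated_image i n (h : {linear 'rV[R]_n -> M i}) :
  (forall v, h v \in union_sub i) -> exists2 L, C L & forall v, h v \in L i.
Proof.
move=> hU; have [s sP] := rV_span R n.
have [L CL hL] := @union_fin_generated i _ s h (fun v _ => hU v).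
by exists L => // v; apply: hL.
Qed.

(** Conditions on the members of the chain that are inherited by larger members
    and hold trivially outside a bounded range of degrees can be met in all
    degrees at once. *)
Lemma union_uniform (Q : int -> subcomplex M -> Prop) (a b : int) :
  (forall i, exists2 L, C L & Q i L) ->
  (forall i L L', sub_le L L' -> Q i L -> Q i L') ->
  (forall i L, (i < a) || (b < i) -> Q i L) ->
  exists2 L, C L & forall i, Q i L.
Proof.
move=> Qex Qmono Qout.
have Qfin n : exists2 L, C L & forall k, (k < n)%N -> Q (a + k%:Z) L.
  elim: n => [|n [L CL LQ]]; first by exists L0.
  have [L' CL' LQ'] := Qex (a + n%:Z).
  have [le|le] := C_total CL CL'; [exists L' => //|exists L => //];
    move=> k; rewrite ltnS leq_eqVlt => /orP[/eqP ->|kn] //.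
  - exact: Qmono le (LQ _ kn).
  - exact: Qmono le LQ'.
  - exact: LQ.
have [L CL LQ] := Qfin `|b - a|.+1%N; exists L => // i.
have [ia|ai] := ltP i a; first by apply: Qout; rewrite ia.
have [bi|ib] := ltP b i; first by apply: Qout; rewrite bi orbT.
have -> : i = a + `|i - a|%N%:Z.
  rewrite gez0_abs; last by rewrite subr_ge0.
  by rewrite [RHS]addrC subrK.
apply: LQ; rewrite ltnS -lez_nat !gez0_abs ?subr_ge0 ?lerB //.
exact: le_trans ai ib.
Qed.

(** A chain map out of a bounded complex of finitely presented modules is
    given by lifts to M of finitely many generators, subject to finitely many
    conditions that certain elements of M lie in the subcomplex.  If they lie in
    the union then they lie in one member of the chain. *)
Lemma union_sub_pure :
  (forall L, C L -> pure_epi_cx (proj_cx L)) -> pure_epi_cx (proj_cx union_sub).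
Proof.
move=> pC A bA fA w; have [a [b ab]] := bA.
have /dependent_choice_fun[np npP] : forall i,
    exists np : {n : nat & {linear 'rV[R]_n -> A i}},
      (forall x, exists v, projT2 np v = x) /\
      exists m (q : {linear 'rV[R]_m -> 'rV[R]_(projT1 np)}),
        forall v, projT2 np v = 0 <-> exists u, q u = v.
  move=> i; have [m [n [q [p [ps pq]]]]] := fA i.
  by exists (existT _ n p); split=> //; exists m, q.
pose n i := projT1 (np i); pose p i : {linear 'rV[R]_(n i) -> A i} := projT2 (np i).
have ps i x : exists v, p i v = x by apply: (npP i).1.
(* y lifts w on generators; it has to vanish outside the range of A, where
   otherwise infinitely many conditions could remain *)
have /dependent_choice_fun[y yP] : forall i,
    exists y : {linear 'rV[R]_(n i) -> M i},
      (forall v, quot_pi _ (y v) = w i (p i v)) /\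
      ((i < a) || (b < i) -> forall v, y v = 0).
  move=> i; have [iab|iab] := boolP ((i < a) || (b < i)).
    exists \0; split=> // v; rewrite [p i v](ab i iab) !linear0 //.
  have [|y yP] := rV_lift (g := sub_proj (union_sub i))
    (w i \o p i : {linear _ -> _}); first exact: quot_surj.
  by exists y.
have /dependent_choice_fun[D DP] : forall i,
    exists D : {linear 'rV[R]_(n (i + 1)) -> 'rV[R]_(n i)},
      forall v, p i (D v) = cx_d A i (p (i + 1) v).
  by move=> i; apply: (rV_lift (cx_d A i \o p (i + 1)) (ps i)).
(* y induces a chain map from A to M/L *)
pose Q i (L : subcomplex M) := (forall v, p i v = 0 -> y i v \in L i) /\
  (forall v, y i (D i v) - cx_d M i (y (i + 1) v) \in L i).
(* Q i L involves the degrees i and i + 1, whence the range a - 1, ..., b *)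
have [||i|L CL LQ] := @union_uniform Q (a - 1) b.
- move=> i; have [_ [m [q qP]]] := npP i.
  have [|L CL hL] := union_fin_generated_image (h := y i \o q : {linear _ -> _}).
    move=> v; apply/quot_pi_eq0; rewrite /= (yP i).1.
    by rewrite (_ : p i _ = 0) ?linear0 //; apply/qP; exists v.
  have [|L' CL' hL'] := union_fin_generated_image
      (h := (y i \o D i) \- (cx_d M i \o y (i + 1)) : {linear _ -> M i}).
    move=> v; apply/quot_piP; rewrite /= (yP i).1 DP cm_comm -(yP (i + 1)).1.
    exact: (quot_d_pi union_sub).
  have [le|le] := C_total CL CL'; [exists L' => //|exists L => //]; split=> v.
  + by move=> /qP[u <-]; apply/le/hL.
  + exact: hL'.
  + by move=> /qP[u <-]; apply: hL.
  + exact/le/hL'.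
- by move=> i L L' le [Q1 Q2]; split=> v; [move/Q1; apply: le | apply/le/Q2].
- move=> L iab.
  have yi : (i < a) || (b < i).
    case/orP: iab => [ia|->]; rewrite ?orbT //.
    by rewrite (lt_trans ia) // gtrBl.
  have yi1 : (i + 1 < a) || (b < i + 1).
    case/orP: iab => [ia|bi]; first by rewrite -ltrBrDr ia.
    by rewrite (lt_trans bi) ?orbT // ltrDl.
  split=> v; rewrite ?((yP i).2 yi) ?rpred0 //.
  by rewrite ((yP (i + 1)).2 yi1) linear0 subrr rpred0.
have /dependent_choice_fun[f fP] : forall i,
    exists f : {linear A i -> quot_mod (L i)}, forall v, f (p i v) = quot_pi _ (y i v).
  move=> i; apply: (factor_surj (f := sub_proj (L i) \o y i)) => [|v pv].
    exact: ps.
  by apply/quot_pi_eq0; have [Q1 _] := LQ i; apply: Q1.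
have fc i x : f i (cx_d A i x) = cx_d (quot_cx L) i (f (i + 1) x).
  have [v <-] := ps (i + 1) x; rewrite -DP !fP /= quot_d_pi.
  by apply/quot_piP; have [_ Q2] := LQ i.
have [v vP] := pC L CL A bA fA (@ChainMap _ A (quot_cx L) f fc).
exists v => i x; have [u <-] := ps i x.
rewrite -(yP i).1; apply/quot_piP/(union_sub_ge CL)/quot_piP.
by rewrite -fP; apply: vP.
Qed.

Lemma union_sub_acyclic :
  (forall L, C L -> pure_acyclic (sub_cx L)) -> pure_acyclic (sub_cx union_sub).
Proof.
move=> aC; apply/pure_acyclic_subE => A fA i w wU dw.
have [n [p ps]] := fin_presented_generated fA.
have [|L CL hL] := union_fin_generated_image (h := w \o p : {linear _ -> _}).
  by move=> v; apply: wU.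
have [|v [vL dv]] := (pure_acyclic_subE L).1 (aC L CL) A fA i w _ dw.
  by move=> a; have [u <-] := ps a; apply: hL.
by exists v; split=> // a; apply/(union_sub_ge CL)/vL.
Qed.

End Union.

Lemma maximal_pure_acyclic : exists P : subcomplex M,
  [/\ pure_epi_cx (proj_cx P), pure_acyclic (sub_cx P)
    & forall L, pure_epi_cx (proj_cx L) -> pure_acyclic (sub_cx L) ->
        sub_le P L -> sub_le L P].
Proof.
pose T := {L : subcomplex M | pure_epi_cx (proj_cx L) /\ pure_acyclic (sub_cx L)}.
pose le (L L' : T) := `[< sub_le (sval L) (sval L') >].
pose mkT L (pL : pure_epi_cx (proj_cx L)) (aL : pure_acyclic (sub_cx L)) : T :=
  exist _ L (conj pL aL).
pose t0 := mkT _ zero_sub_pure zero_sub_acyclic.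
have [||F Ftot|[P [pP aP]] Pmax] := @ZL_preorder T t0 le.
- by move=> L; apply/asboolP.
- move=> L L' L'' /asboolP LL' /asboolP L'L''; apply/asboolP => i x /LL'.
  exact: L'L''.
- have [[K FK]|F0] := pselect (exists K, F K); last first.
    by exists t0 => L FL; case: F0; exists L.
  pose C L := exists2 t : T, F t & sval t = L.
  have Ctot L L' : C L -> C L' -> sub_le L L' \/ sub_le L' L.
    move=> [t Ft <-] [t' Ft' <-].
    by have [/asboolP|/asboolP] := Ftot _ _ Ft Ft'; [left|right].
  have CK : C (sval K) by exists K.
  have pU : pure_epi_cx (proj_cx (union_sub Ctot CK)).
    by apply: union_sub_pure => _ [t _ <-]; apply: (svalP t).1.
  have aU : pure_acyclic (sub_cx (union_sub Ctot CK)).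
    by apply: union_sub_acyclic => _ [t _ <-]; apply: (svalP t).2.
  exists (mkT _ pU aU) => L FL; apply/asboolP/union_sub_ge.
  by exists L.
exists P; split=> // L pL aL PL.
have := Pmax (mkT _ pL aL) (asboolT PL).
by move/asboolP.
Qed.

Lemma maximal_quotient_minimal (P : subcomplex M) :
  pure_epi_cx (proj_cx P) -> pure_acyclic (sub_cx P) ->
  (forall L, pure_epi_cx (proj_cx L) -> pure_acyclic (sub_cx L) ->
     sub_le P L -> sub_le L P) ->
  pure_minimal (quot_cx P).
Proof.
move=> pP aP Pmax L /pure_subcomplexE pL aL i x xL.
have [m mx] := quot_surj x; rewrite -mx; apply/quot_pi_eq0.
apply: (Pmax (preimage_sub L)).
- exact: preimage_sub_pure.
- exact: preimage_sub_acyclic.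
- exact: preimage_sub_ge.
- by apply/preimage_subE; rewrite mx.
Qed.

End Maximal.

Theorem mainTheorem4 (R : pzRingType) (M : complex R) :
  (exists P : subcomplex M,
     [/\ pure_exact_cx (incl_cx P) (proj_cx P),
         pure_acyclic (sub_cx P)
       & pure_minimal (quot_cx P)]) /\
  ([\/ left_noetherian R /\ (forall i, injective_mod (M i)),
       left_perfect R /\ (forall i, projective_mod (M i)),
       semi_perfect R /\
         (forall i, fin_generated (M i) /\ projective_mod (M i))
     | left_noetherian R /\
         (forall i, fin_generated (M i) /\ projective_mod (M i))] ->
   forall P : subcomplex M,
     pure_exact_cx (incl_cx P) (proj_cx P) ->
     pure_acyclic (sub_cx P) ->
     pure_minimal (quot_cx P) ->
     [/\ split_cx (incl_cx P) (proj_cx P),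
         exists phi : chain_map M (dsum (sub_cx P) (quot_cx P)),
           [/\ chain_iso phi,
               forall i x, phi i (incl_cx P i x) = (x, 0%R)
             & forall i x, (phi i x).2 = proj_cx P i x],
         contractible (sub_cx P)
       & pure_minimal (quot_cx P)]).
Proof.
split.
  have [P [pP aP Pmax]] := maximal_pure_acyclic M.
  exists P; split=> //; first exact/pure_subcomplexE.
  exact: maximal_quotient_minimal.
move=> cond P pP aP mP.
have [K Ksplit KM] : exists2 K, pure_split_class K & forall i, K (M i).
  case: cond => -[HR HM].
  - by exists (@injective_mod R) => //; apply: injective_split_class.
  - by exists (@projective_mod R) => //; apply: projective_split_class.
  - by exists (@fg_projective R) => //; apply: fg_projective_split_class_semi_perfect.
  - by exists (@fg_projective R) => //; apply: fg_projective_split_class_noetherian.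
by have [? ? ?] := pure_subcomplex_split Ksplit KM pP aP.
Qed.
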